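(* Let $\Gamma$ be a hyperelliptic metric graph of genus at least two without one valent points, and let $\iota$ be its hyperelliptic involution. Then the $\langle\iota\rangle$-invariant linear system $|K_\Gamma|^{\langle\iota\rangle}$ of the canonical linear system $|K_\Gamma|$ induces a rational map $\phi_{|K_\Gamma|^{\langle\iota\rangle}}$ whose image is a tree and which is an $\langle\iota\rangle$-Galois covering on the image (with edge-multiplicities $1$ on $\Gamma$ and $|K_e|$ on the image of an edge $e$, where $K=\langle\iota\rangle$).
   Context: Metric graph: the underlying metric space of an edge-weighted graph $(G,l)$, where $G$ is a finite connected nonempty multigraph (loops allowed) and $l:E(G)\to\mathbb{R}_{>0}\cup\{\infty\}$ may take the value $\infty$ only on leaf edges (so all lengths are finite when there are no one valent points). Each edge $e$ is identified with $[0,l(e)]$. $(G,l)$ is called a model, a loopless model if $G$ has no loops. The genus is the first Betti number; a tree is a metric graph of genus $0$. The valence $\mathrm{val}(x)$ is the number of half-edges of $x$, i.e. of connected components of $U\setminus\{x\}$ for a sufficiently small connected neighborhood $U$ of $x$. A divisor is an element $D=\sum D(x)\cdot x$ of the free abelian group on the points of $\Gamma$, of degree $\sum D(x)$; effective means all $D(x)\ge0$. The canonical divisor is $K_\Gamma=\sum_{x}(\mathrm{val}(x)-2)\cdot x$. A rational function is the constant $-\infty$ or a continuous piecewise linear function with integer slopes and finitely many pieces. For $f\not\equiv-\infty$, $\mathrm{div}(f)=\sum_x\mathrm{ord}_x(f)\cdot x$, with $\mathrm{ord}_x(f)$ the sum of outgoing slopes at $x$. Divisors differing by some $\mathrm{div}(f)$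 are linearly equivalent; $|D|$ is the set of effective divisors linearly equivalent to $D$. The rank $r(D)$ is the minimum integer $s$ such that $|D-E|=\emptyset$ for some effective $E$ of degree $s+1$. A metric graph of genus at least two is hyperelliptic if it has a divisor of degree two and rank one. A hyperelliptic involution is an isometric involution $\iota$ with $\Gamma/\langle\iota\rangle$ a tree; for a hyperelliptic $\Gamma$ without one valent points it exists and is unique. $R(D)=\{f\not\equiv-\infty: D+\mathrm{div}(f)\ge0\}\cup\{-\infty\}$; for a finite group $K$ acting isometrically on $\Gamma$ and a $K$-invariant effective divisor $D$, $R(D)^K=\{f\in R(D): f\circ\sigma=f\ \forall\sigma\in K\}$, a finitely generated tropical semimodule over $\boldsymbol{T}=(\mathbb{R}\cup\{-\infty\},\oplus=\max,\odot=+)$ under pointwise operations. $|D|^K$ is the set of $K$-invariant elements of $|D|$, identified with $R(D)^K$ modulo additive constants. $\boldsymbol{TP}^{n-1}=(\boldsymbol{T}^{n}\setminus\{(-\infty,\dots,-\infty)\})/\sim$, where $\boldsymbol{x}\sim\boldsymbol{y}$ iff $\boldsymbol{x}=\boldsymbol{y}+(\lambda,\dots,\lambda)$ for some real $\lambda$. For a minimal generating set $\{f_1,\dots,f_n\}$ of $R(D)^K$ (unique up to order and additive constants), $\phi_{|D|^K}(x)=(f_1(x):\cdots:f_n(x))\in\boldsymbol{TP}^{n-1}$. Lattice length: if $u\ne v$ have real coordinates and $(u_j-u_i)-(v_j-v_i)=\lambda w_j$ for all $j$, with $\lambda>0$ and $w$ an integer vector with entries of greatest common divisor $1$, their distance is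 $\lambda$ (independent of $i$). The image is regarded as a metric graph by giving the image of each segment on which all $f_i$ are linear its lattice length. Morphism: a continuous map $\varphi:\Gamma\to\Gamma'$ of metric graphs for which there are models $(G,l),(G',l')$ with $\varphi(V(G))\subset V(G')$, such that the inverse image of the relative interior of each edge of $G'$ is the union of relative interiors of finitely many edges of $G$, and $\varphi$ on each edge $e$ of $G$ is a dilation by an integer factor $\deg_e(\varphi)\ge0$. Finite: all $\deg_e(\varphi)>0$. For a half-edge $h\subset e$, $\deg_h(\varphi)=\deg_e(\varphi)$. With loopless models and edge-multiplicity functions $m:E(G)\to\mathbb{Z}_{>0}$, $m':E(G')\to\mathbb{Z}_{>0}$ (with $m'(\varphi(e))=0$ if $e$ is contracted) and $\Gamma'$ not a singleton, $\varphi$ is harmonic at $x$ if $m(e_1)\mid m'(\varphi(e_1))$ for each edge $e_1$ adjacent to $x$ and $\deg_x^{m,m'}(\varphi)=\sum_h\frac{m'(\varphi(e))}{m(e)}\deg_h(\varphi)$ is independent of the half-edge $h'$ at $\varphi(x)$, where $h$ runs over the half-edges of $x$ mapped to $h'$ and $e\supset h$. Harmonic: harmonic at all points; $\deg^{m,m'}(\varphi)=\sum_{x\in\varphi^{-1}(x')}\deg_x^{m,m'}(\varphi)$, independent of $x'$. $\varphi$ is a $K$-Galois covering with edge-multiplicities $m,m'$ if it is a finite harmonic morphism with respect to $m,m'$, $\deg^{m,m'}(\varphi)=|K|$, $K$ acts transitively on every fibre, and $K$ preserves the edge-multiplicities. In the claim the models are some loopless models, $m\equiv1$, and $m'(e')=|K_e|$,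 where $e$ is any edge with image $e'$ and $K_e$ is its stabilizer. *)

(* Defs.v *)
From HB Require Import structures.
From mathcomp Require Import all_boot all_order all_algebra finmap.
From mathcomp Require Import all_classical all_reals all_analysis.

Set Implicit Arguments.
Unset Strict Implicit.
Unset Printing Implicit Defensive.

Import Order.TTheory GRing.Theory Num.Theory.
Import numFieldNormedType.Exports.

Local Open Scope classical_set_scope.
Local Open Scope ring_scope.

(** * Path metrics

    [step x y a] says that [x] and [y] are joined by an elementary segment of
    length [a]; [chain_dist] is the infimum of the lengths of chains of
    segments. *)

Inductive chain (R : realType) (T : Type) (step : T -> T -> R -> Prop) :
    T -> T -> R -> Prop :=
| chain_nil x : chain step x x 0
| chain_cons x y z a b :
    step x y a -> chain step y z b -> chain step x z (a + b).

Definition chain_dist (R : realType) (T : Type) (step : T -> T -> R -> Prop)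
  (x y : T) : R := inf [set L | chain step x y L].

(** * Metric graphs *)

(** Finite multigraphs; an edge with [src e = tgt e] is a loop. The
    orientation only serves to parametrize the edges. *)
Record graph := Graph {
  vertex : finType;
  edge : finType;
  src : edge -> vertex;
  tgt : edge -> vertex }.

Definition adjacent (G : graph) (u v : vertex G) : bool :=
  [exists e : edge G, ((src e == u) && (tgt e == v))
                   || ((src e == v) && (tgt e == u))].

Definition connected_graph (G : graph) : Prop :=
  (0 < #|vertex G|)%N /\ forall u v : vertex G, connect (@adjacent G) u v.

Definition loopless (G : graph) : Prop := forall e : edge G, src e != tgt e.

(** The first Betti number [#|E| - #|V| + 1] of a connected graph. *)
Definition betti (G : graph) : nat := (#|edge G|.+1 - #|vertex G|)%N.

Definition edge_step (R : realType) (T : Type) (E : Type) (len : E -> R)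
    (chart : E -> R -> T) (x y : T) (a : R) : Prop :=
  exists e s t, [/\ 0 <= s <= len e, 0 <= t <= len e,
    chart e s = x, chart e t = y & a = `|s - t| ].

(** A model of the metric space [X]: an edge-weighted graph together with an
    isometry from its underlying metric space onto [X]. The edge [e] is
    identified with [`[0, len e]] through [chart e] (the values of [chart e]
    outside this interval are irrelevant). All lengths are finite: infinite
    lengths only occur on leaf edges, that is, in the presence of one valent
    points. *)
Record model (R : realType) (X : metricType R) := Model {
  gr :> graph;
  gr_connected : connected_graph gr;
  len : edge gr -> R;
  len_gt0 : forall e, 0 < len e;
  vtx : vertex gr -> X;
  chart : edge gr -> R -> X;
  chart_src : forall e, chart e 0 = vtx (src e);
  chart_tgt : forall e, chart e (len e) = vtx (tgt e);
  vtx_inj : injective vtx;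
  chart_inj : forall e e' (s t : R), 0 < s < len e -> 0 < t < len e' ->
    chart e s = chart e' t -> e = e' /\ s = t;
  chart_vtx : forall e (s : R) v, 0 < s < len e -> chart e s <> vtx v;
  chart_cover : forall x,
    (exists v, x = vtx v) \/ (exists e (s : R), 0 < s < len e /\ x = chart e s);
  model_dist : forall x y, mdist x y = chain_dist (edge_step len chart) x y }.

Section MetricGraph.
Context {R : realType} {X : metricType R} (G : model X).

Definition edge_set (e : edge G) : set X :=
  [set chart e s | s in [set s | 0 <= s <= len e]].

Definition edge_relint (e : edge G) : set X :=
  [set chart e s | s in [set s | 0 < s < len e]].

Definition genus : nat := betti G.

(** A half-edge [(e, b, s)] is the germ, at the point [chart e s], of the edge
    [e] followed in the increasing ([b = true]) or decreasing ([b = false])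
    direction. The points in the relative interior of an edge thus have two
    half-edges, and a loop contributes two half-edges to its base point. *)
Definition half_edge : Type := (edge G * bool * R)%type.

Definition half_edge_at (x : X) : set half_edge :=
  [set h | chart h.1.1 h.2 = x /\
    if h.1.2 then 0 <= h.2 < len h.1.1 else 0 < h.2 <= len h.1.1].

Definition half_edge_point (h : half_edge) (r : R) : X :=
  chart h.1.1 (if h.1.2 then h.2 + r else h.2 - r).

Definition valence (x : X) : nat := #|` fset_set (half_edge_at x)|%fset.

(** ** Rational functions (other than the constant [-oo]) *)

(** On each edge there are finitely many break points, and the function is
    linear with integer slope on every interval without break point in its
    interior. *)
Definition piecewise_linear (f : X -> R) : Prop :=
  forall e : edge G, exists brk : seq R, forall s t : R,
    0 <= s -> s <= t -> t <= len e -> (forall r, r \in brk -> ~~ (s < r < t)) ->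
    exists k : int, forall r, s <= r <= t ->
      f (chart e r) = f (chart e s) + k%:~R * (r - s).

Definition rational_fun (f : X -> R) : Prop :=
  continuous f /\ piecewise_linear f.

Definition slope (f : X -> R) (h : half_edge) : int :=
  xget 0 [set k : int | exists2 eps : R, 0 < eps & forall r, 0 <= r <= eps ->
    f (half_edge_point h r) = f (half_edge_point h 0) + k%:~R * r].

(** The sum of the outgoing slopes at [x]. *)
Definition ord (f : X -> R) (x : X) : int :=
  \sum_(h \in half_edge_at x) slope f h.

(** ** Divisors, as finitely supported functions to [int] *)

Definition divisor (D : X -> int) : Prop := finite_set [set x | D x != 0].

Definition degree (D : X -> int) : int := \sum_(x \in [set: X]) D x.

Definition effective (D : X -> int) : Prop := forall x, 0 <= D x.

Definition canonical_div : X -> int := fun x => (valence x)%:Z - 2.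

Definition lin_equiv (D D' : X -> int) : Prop :=
  exists2 f, rational_fun f & forall x, D' x = D x + ord f x.

Definition complete_system (D : X -> int) : set (X -> int) :=
  [set D' | [/\ divisor D', effective D' & lin_equiv D D']].

Definition has_rank (D : X -> int) (r : int) : Prop :=
  let S : set int := [set s | exists E, [/\ divisor E, effective E,
    degree E = s + 1 & complete_system (fun x => D x - E x) = set0]] in
  S r /\ forall s, S s -> r <= s.

Definition hyperelliptic : Prop :=
  (2 <= genus)%N /\ exists D, [/\ divisor D, degree D = 2 & has_rank D 1].

(** ** The tropical semimodule [R(D)^K]

    The tropical semifield is [\bar R] without [+oo], with [maxe] as addition
    and [adde] as multiplication. *)

Definition sections (D : X -> int) : set (X -> \bar R) :=
  [set f | f = cst -oo%E \/
    exists2 g : X -> R, rational_fun g /\ effective (fun x => D x + ord g x)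
                      & f = EFin \o g].

Definition inv_sections (D : X -> int) (K : {fset (X -> X)})
    : set (X -> \bar R) :=
  [set f | sections D f /\ forall sigma : X -> X, sigma \in K -> f \o sigma = f].

End MetricGraph.

Definition is_tree (R : realType) (X : metricType R) : Prop :=
  exists G : model X, genus G = 0%N.

Definition generates (R : realType) (T : Type) (n : nat)
    (f : 'I_n -> T -> \bar R) (J : {set 'I_n}) (S : set (T -> \bar R)) : Prop :=
  (forall i, i \in J -> S (f i)) /\
  forall g, S g -> exists2 a : 'I_n -> \bar R, (forall i, a i != +oo%E) &
    forall x, g x = \big[maxe/-oo%E]_(i in J) (a i + f i x)%E.

Definition minimal_generating (R : realType) (T : Type) (n : nat)
    (f : 'I_n -> T -> \bar R) (S : set (T -> \bar R)) : Prop :=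
  generates f [set: 'I_n]%SET S /\
  forall J : {set 'I_n}, generates f J S -> J = [set: 'I_n]%SET.

(** * Tropical projective space and the metric of the image *)

(** The class of [v] under tropical scaling, as a set of vectors. *)
Definition tp_class (R : realType) (n : nat) (v : 'I_n -> \bar R)
    : set ('I_n -> \bar R) :=
  [set w | exists l : R, forall i, w i = (v i + l%:E)%E].

Definition trop_proj (R : realType) (n : nat) : set (set ('I_n -> \bar R)) :=
  [set tp_class v | v in
    [set v | (forall i, v i != +oo%E) /\ exists i, v i != -oo%E]].

Definition rational_map (R : realType) (T : Type) (n : nat)
    (f : 'I_n -> T -> \bar R) (x : T) : set ('I_n -> \bar R) :=
  tp_class (fun i => f i x).

(** [P] and [Q] are distinct classes of real vectors, at lattice distance [a]. *)
Definition lattice_length (R : realType) (n : nat)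
    (P Q : set ('I_n -> \bar R)) (a : R) : Prop :=
  [/\ 0 < a, P <> Q & exists u v : 'I_n -> R,
    [/\ P = tp_class (EFin \o u), Q = tp_class (EFin \o v) &
    exists (i : 'I_n) (w : 'I_n -> int),
      \big[gcdn/0%N]_(j < n) `|w j|%N = 1%N /\
      forall j, (u j - u i) - (v j - v i) = a * (w j)%:~R]].

(** [P] and [Q] are the ends of the image of a segment of an edge on which all
    the [f i] are linear, and [a] is the lattice length of this image. *)
Definition image_step (R : realType) (X : metricType R) (G : model X) (n : nat)
    (f : 'I_n -> X -> \bar R) (P Q : set ('I_n -> \bar R)) (a : R) : Prop :=
  exists (e : edge G) (s t : R),
    [/\ 0 <= s <= len e, 0 <= t <= len e,
      forall i, exists c k : R, forall r,
        Num.min s t <= r <= Num.max s t -> f i (chart e r) = (c + k * r)%:E,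
      rational_map f (chart e s) = P /\ rational_map f (chart e t) = Q &
      (P = Q /\ a = 0) \/ lattice_length P Q a].

(** [beta] identifies [Y] with the image of [rational_map f], carrying the
    path metric given by the lattice lengths. *)
Definition is_image (R : realType) (X : metricType R) (G : model X) (n : nat)
    (f : 'I_n -> X -> \bar R) (Y : metricType R)
    (beta : Y -> set ('I_n -> \bar R)) : Prop :=
  [/\ injective beta, range beta = range (rational_map f) &
    forall y y', mdist y y' = chain_dist (image_step G f) (beta y) (beta y')].

(** * Finite groups of isometries and quotients *)

Definition isometric (R : realType) (X : metricType R) (sigma : X -> X) : Prop :=
  forall x y, mdist (sigma x) (sigma y) = mdist x y.

Definition isometry_group (R : realType) (X : metricType R)
    (K : {fset (X -> X)}) : Prop :=
  [/\ (idfun : X -> X) \in K,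
    forall sigma tau : X -> X, sigma \in K -> tau \in K ->
      (sigma \o tau : X -> X) \in K,
    forall sigma : X -> X, sigma \in K ->
      exists2 tau : X -> X, tau \in K & cancel sigma tau /\ cancel tau sigma &
    forall sigma : X -> X, sigma \in K -> isometric sigma].

(** [q] identifies [Y] with the quotient of [X] by [K], with the distance
    between orbits as metric. *)
Definition is_quotient (R : realType) (X Y : metricType R)
    (K : {fset (X -> X)}) (q : X -> Y) : Prop :=
  [/\ range q = [set: Y],
    forall x x', q x = q x' <-> exists2 sigma : X -> X, sigma \in K & sigma x = x' &
    forall x x', mdist (q x) (q x') =
      inf [set mdist x (sigma x') | sigma in [set` K]]].

(** The group generated by an involution. *)
Definition invol_group (R : realType) (X : metricType R) (iota : X -> X)
    : {fset (X -> X)} := [fset (idfun : X -> X); iota]%fset.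

(** Being of order two, [iota] is not the identity. *)
Definition hyperelliptic_involution (R : realType) (X : metricType R)
    (iota : X -> X) : Prop :=
  [/\ isometric iota, involutive iota, iota <> idfun :> (X -> X) &
    exists (Y : metricType R) (q : X -> Y),
      is_quotient (invol_group iota) q /\ is_tree Y].

(** * Morphisms, harmonic morphisms and Galois coverings *)

Section Morphism.
Context {R : realType} {X Y : metricType R}.
Variables (phi : X -> Y) (G : model X) (G' : model Y).

(** [phi] maps [e] onto [e'] as a dilation by the positive factor [k],
    preserving ([b = true]) or reversing the orientation. *)
Definition dilates (e : edge G) (e' : edge G') (b : bool) (k : nat) : Prop :=
  [/\ (0 < k)%N, len e' = k%:R * len e &
    forall s, 0 <= s <= len e ->
      phi (chart e s) = chart e' (if b then k%:R * s else len e' - k%:R * s)].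

Definition edge_over (e : edge G) (e' : edge G') : Prop :=
  exists b k, dilates e e' b k.

Definition contracts (e : edge G) : Prop :=
  exists v : vertex G', forall s, 0 <= s <= len e -> phi (chart e s) = vtx v.

(** [phi] is a morphism with respect to the models [G] and [G'], with
    [deg e] as factor on the edge [e]. *)
Definition is_morphism (deg : edge G -> nat) : Prop :=
  [/\ continuous phi,
    forall v : vertex G, exists v' : vertex G', phi (vtx v) = vtx v',
    forall e' : edge G', exists J : {set edge G},
      phi @^-1` (edge_relint e') = \bigcup_(e in [set` J]) edge_relint e &
    forall e, (deg e = 0%N /\ contracts e) \/
              (exists e' b, dilates e e' b (deg e))].

Definition finite_morphism (deg : edge G -> nat) : Prop :=
  is_morphism deg /\ forall e, (0 < deg e)%N.

Definition half_edge_over (h : half_edge G) (h' : half_edge G') : Prop :=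
  exists b k, [/\ dilates h.1.1 h'.1.1 b k,
    h'.1.2 = (if b then h.1.2 else ~~ h.1.2) &
    h'.2 = if b then k%:R * h.2 else len h'.1.1 - k%:R * h.2].

Variables (deg : edge G -> nat) (m : edge G -> nat) (m' : edge G' -> nat).

Definition half_edge_degree (x : X) (h' : half_edge G') : nat :=
  (\big[addn/0%N]_(h \in [set h | half_edge_at x h /\ half_edge_over h h'])
     (m' h'.1.1 %/ m h.1.1 * deg h.1.1))%N.

Definition local_degree (x : X) (d : nat) : Prop :=
  forall h', half_edge_at (phi x) h' -> half_edge_degree x h' = d.

(** For a contracted edge the divisibility condition reads [m e %| 0]. *)
Definition harmonic_at (x : X) : Prop :=
  (forall (h : half_edge G) e', half_edge_at x h -> edge_over h.1.1 e' ->
     (m h.1.1 %| m' e')%N) /\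
  exists d, local_degree x d.

Definition harmonic_morphism : Prop :=
  [/\ loopless G, loopless G',
    (forall e, 0 < m e)%N /\ (forall e', 0 < m' e')%N,
    exists y y' : Y, y <> y' &
    forall x, harmonic_at x].

Definition has_degree (d : nat) : Prop :=
  exists2 ldeg : X -> nat, forall x, local_degree x (ldeg x) &
    forall y, (\big[addn/0%N]_(x \in phi @^-1` [set y]) ldeg x)%N = d.

(** Every element of [K] permutes the edges of [G] and preserves [m]. *)
Definition preserves_mult (K : {fset (X -> X)}) : Prop :=
  forall sigma : X -> X, sigma \in K -> forall e : edge G, exists2 e2 : edge G,
    sigma @` edge_relint e = edge_relint e2 & m e2 = m e.

Definition galois_covering (K : {fset (X -> X)}) : Prop :=
  [/\ isometry_group K, finite_morphism deg /\ harmonic_morphism, has_degree #|` K|%fset,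
    (forall x x', phi x = phi x' <-> exists2 sigma : X -> X, sigma \in K & sigma x = x') &
    preserves_mult K].

Definition edge_stab (K : {fset (X -> X)}) (e : edge G) : {fset (X -> X)} :=
  [fset sigma in K | `[< (sigma @` edge_set e = edge_set e)%classic >]]%fset.

End Morphism.

(* Main.v *)
Require Import Defs.
From HB Require Import structures.
From mathcomp Require Import all_boot all_order all_algebra finmap.
From mathcomp Require Import all_classical all_reals all_analysis.
From mathcomp Require Import zify lra ring.

Set Implicit Arguments.
Unset Strict Implicit.
Unset Printing Implicit Defensive.

Import Order.TTheory GRing.Theory Num.Theory.
Import numFieldNormedType.Exports.

Local Open Scope classical_set_scope.
Local Open Scope ring_scope.

(** Let [q : X -> T] be the quotient by [iota]; an [iota]-invariant function is a
    function on the tree [T]. Give each edge of [T] the number of edges above it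
    as weight, 1 or 2, and let [kappa] be the push-forward of the canonical
    divisor. As no point is one valent, [kappa >= 0], and [kappa] has total
    [2g - 2 >= 2]; counting half-edges, the [kappa]-mass of each side of an edge
    is congruent to the weight of this edge mod 2, hence divisible by it.
    So on at least one side of any given edge [e0] there are enough chips to let
    all of them flow with integer slopes to [e0], and then as many as the weight
    across it: this is an invariant section with slope 1 on [e0] and with
    distinct values at points on different sides of [e0]. Since any
    segment of [X] can be refined to contain such an edge, these sections
    separate the points of [T], and the slopes of the generators on any
    segment include 0 (from the constant section) and 1 or -1, so the
    lattice length of its image is its own length. Hence the rational map is [q]
    followed by an isometric identification of [T] with the image, and [q] is a
    Galois covering for models of [X] and [T] subdivided compatibly. *)

(** * Metric models *)

(** No generator is ever computed: nothing is known about the generators beyond minimality. Sections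
    built on the tree still say something about them because of tropical generation itself: at each
    point some generator, up to a constant, touches the given section from below, and at an interior
    point of a segment on which both are linear this forces equal slopes.

    The weights are what makes orders descend: at a vertex [v] over [v'], the order of an invariant
    function, multiplied by the number of points above [v'], is the sum of weight times slope over
    the darts at [v']. Slopes are therefore fluxes divided by weights, and parity makes these
    quotients integral.

    Distances in a model are infima over chains, while the quotient carries the distance between
    orbits. The bridge is that [q] is short and lifts distances: once the vertices upstairs are
    exactly the points above the vertices downstairs, it carries each edge onto an edge with factor
    1. *)

Section ChainDistance.
Context {R : realType} (T : Type) (step : T -> T -> R -> Prop).
Hypothesis step_ge0 : forall x y a, step x y a -> 0 <= a.

Lemma chain_ge0 x y L : chain step x y L -> 0 <= L.
Proof. by elim=> // {}x {}y z a b /step_ge0 a0 _ b0; exact: addr_ge0. Qed.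

Lemma chain_dist_le x y L : chain step x y L -> chain_dist step x y <= L.
Proof.
move=> xyL; apply: ge_inf => //; exists 0 => L' /=.
exact: chain_ge0.
Qed.

(** A chain has to be supplied because [inf] of the empty set is 0, which lies below any positive
    [m]. *)
Lemma chain_dist_ge x y m L0 : chain step x y L0 ->
  (forall L, chain step x y L -> m <= L) -> m <= chain_dist step x y.
Proof. by move=> xyL mL; apply: lb_le_inf => //; exists L0. Qed.

End ChainDistance.

Lemma chain_cat (R : realType) (T : Type) (step : T -> T -> R -> Prop)
    x y z (a b : R) :
  chain step x y a -> chain step y z b -> chain step x z (a + b).
Proof.
elim=> [{}x|{}x {}y w c d xy _ IH] bz; first by rewrite add0r.
by rewrite -addrA; apply: chain_cons xy (IH bz).
Qed.

Lemma lipschitz1_continuous (R : realType) (X Y : metricType R) (p : X -> Y) :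
  (forall x x', mdist (p x) (p x') <= mdist x x') -> continuous p.
Proof.
move=> pL x; apply/metricType_numDomainType.cvgrPdist_lt => eps eps0.
apply/metricType_numDomainType.nbhs_mdistP; exists eps => // x' /= xx'.
exact: le_lt_trans (pL _ _) xx'.
Qed.

Lemma lipschitz_continuous (R : realType) (X : metricType R) (h : X -> R) (C : R) :
  0 < C -> (forall x x', `|h x - h x'| <= C * mdist x x') -> continuous h.
Proof.
move=> C0 hL x; apply/cvgrPdist_lt => eps eps0.
apply/metricType_numDomainType.nbhs_mdistP; exists (eps / C); first exact: divr_gt0.
move=> x' /=; rewrite ltr_pdivlMr// mulrC => xx'.
exact: le_lt_trans (hL _ _) xx'.
Qed.

Section ModelMetric.
Context {R : realType} {X : metricType R} (G : model X).
Implicit Types (e : edge G) (v : vertex G) (x : X).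

Lemma edge_step_ge0 x y (a : R) : edge_step (@len _ _ G) (@chart _ _ G) x y a -> 0 <= a.
Proof. by move=> [e [s [t [_ _ _ _ ->]]]]. Qed.

(** Without a chain the infimum would be taken over the empty set and equal 0; then [x = y], and
    these are joined by the empty chain. *)
Lemma model_chain x y : exists L, chain (edge_step (@len _ _ G) (@chart _ _ G)) x y L.
Proof.
apply: contrapT => no; suff xy : x = y by apply: no; exists 0; rewrite xy; exact: chain_nil.
apply: mdist_positivity; rewrite (model_dist G) /chain_dist.
suff -> : [set L | chain (edge_step (@len _ _ G) (@chart _ _ G)) x y L] = set0.
  by rewrite inf0.
by apply/seteqP; split=> // L /= xyL; apply: no; exists L.
Qed.

Lemma mdist_chart_le e (s t : R) : 0 <= s <= len e -> 0 <= t <= len e ->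
  mdist (chart e s) (chart e t) <= `|s - t|.
Proof.
move=> se te; rewrite (model_dist G) -(addr0 `|s - t|).
apply: chain_dist_le; first exact: edge_step_ge0.
by apply: chain_cons (chain_nil _ _); exists e, s, t.
Qed.

(** The edgewise bounds add up along a chain, hence pass to the infimum. Lower bounds on [mdist] are
    obtained this way from a well chosen [h]. *)
Lemma edgewise_lipschitz (h : X -> R) (C : R) : 0 < C ->
  (forall e (s t : R), 0 <= s <= len e -> 0 <= t <= len e ->
     `|h (chart e s) - h (chart e t)| <= C * `|s - t|) ->
  forall x y, `|h x - h y| <= C * mdist x y.
Proof.
move=> C0 hL x y; rewrite -ler_pdivrMl// (model_dist G).
have [L0 xyL0] := model_chain x y.
apply: chain_dist_ge xyL0 _ => L; rewrite ler_pdivrMl//.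
elim=> [{}x|{}x {}y z a b [e [s [t [se te <- <- ->]]]] _ IH].
  by rewrite subrr normr0 mulr0.
rewrite mulrDr (le_trans (ler_distD (h (chart e t)) _ _))//.
exact: lerD (hL _ _ _ se te) IH.
Qed.

Lemma mem_len e : (0 <= (0 : R) <= len e) * (0 <= len e <= len e).
Proof. by rewrite !lexx (ltW (len_gt0 e)). Qed.

Lemma chart_end e (s : R) : 0 <= s <= len e ->
  [\/ s = 0, s = len e | 0 < s < len e].
Proof.
move=> /andP[]; rewrite le_eqVlt => /orP[/eqP <- _|s0]; first by constructor 1.
rewrite le_eqVlt => /orP[/eqP ->|sl]; first by constructor 2.
by constructor 3; rewrite s0.
Qed.

(** A point is a vertex or an interior point of an edge in exactly one way, so the chosen values are
    forced; the two hypotheses take care of the ends of the edges. *)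
Lemma glue (T : Type) (F : edge G -> R -> T) (phi : vertex G -> T) :
  (forall e, F e 0 = phi (src e)) -> (forall e, F e (len e) = phi (tgt e)) ->
  exists h : X -> T, (forall v, h (vtx v) = phi v) /\
    forall e (s : R), 0 <= s <= len e -> h (chart e s) = F e s.
Proof.
move=> F0 F1.
have /choice[h hP] x : exists r, (exists v, x = vtx v /\ r = phi v) \/
    (exists e s, [/\ 0 < s < len e, x = chart e s & r = F e s]).
  have [[v ->]|[e [s [sl ->]]]] := chart_cover G x.
    by exists (phi v); left; exists v.
  by exists (F e s); right; exists e, s.
have hv v : h (vtx v) = phi v.
  have [[v' [/vtx_inj <- ->//]]|[e [s [sl /esym xs _]]]] := hP (vtx v).
  by have := chart_vtx sl xs.
exists h; split=> // e s /chart_end[->|->|sl].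
- by rewrite chart_src hv F0.
- by rewrite chart_tgt hv F1.
have [[v [xs _]]|[e' [s' [sl' /(chart_inj sl sl')[<- <-] ->//]]]] := hP (chart e s).
by have := chart_vtx sl xs.
Qed.

Lemma linear_extension (phi : vertex G -> R) : exists h : X -> R,
  [/\ forall v, h (vtx v) = phi v,
      forall e (s : R), 0 <= s <= len e ->
        h (chart e s) = phi (src e) + (phi (tgt e) - phi (src e)) / len e * s &
      exists2 C : R, 0 < C & forall x y, `|h x - h y| <= C * mdist x y].
Proof.
have [e|e|h [hv he]] := @glue _
  (fun e s => phi (src e) + (phi (tgt e) - phi (src e)) / len e * s) phi.
- by rewrite mulr0 addr0.
- by rewrite divfK ?gt_eqF ?len_gt0// addrC subrK.
exists h; split=> //.
(* The summand 1 keeps [C] positive even when all slopes vanish. *)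
pose C := 1 + \sum_e `|(phi (tgt e) - phi (src e)) / len e|.
have C0 : 0 < C by rewrite ltr_pwDl// sumr_ge0.
exists C => //; apply: edgewise_lipschitz => // e s t se te.
rewrite !he// opprD addrACA subrr add0r -mulrBr normrM ler_wpM2r//.
rewrite /C (bigD1 e)//= addrCA lerDl addr_ge0//.
by rewrite sumr_ge0.
Qed.

(** The tent function with peak [r] at [chart e s], slopes 1 and -1, and value 0 outside the
    interval of radius [r] is 1-Lipschitz. Comparing its values at the peak and at [x] bounds the
    distance from below by [r] off the tent and by [|s - t|] on it. *)
Lemma tent e (s r : R) : 0 < r -> r <= s -> s + r <= len e -> forall x,
  (exists t, [/\ `|s - t| < r, 0 < t < len e & x = chart e t /\
      mdist (chart e s) x = `|s - t|]) \/ r <= mdist (chart e s) x.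
Proof.
move=> r0 rs sr.
pose F e' (t : R) := if e' == e then Num.max 0 (r - `|s - t|) else 0.
have [e'|e'|h [hv he]] := @glue _ F (fun=> 0).
- rewrite /F; case: ifP => // /eqP _; rewrite subr0 ger0_norm; last lra.
  by apply/max_idPl; lra.
- rewrite /F; case: ifP => // /eqP ->; rewrite distrC ger0_norm; last lra.
  by apply/max_idPl; lra.
have hL x y : `|h x - h y| <= mdist x y.
  rewrite -[leRHS]mul1r; apply: edgewise_lipschitz => // e' t u te ue.
  rewrite !he// mul1r /F; case: ifP => _; last by rewrite subrr normr0.
  have := ler_distD u s t; have := ler_distD t s u; rewrite (distrC u t).
  move=> h1 h2; rewrite ler_norml !maxEge.
  by case: ifP => [|/negbT]; case: ifP => [|/negbT]; rewrite -?ltNge => ? ?; lra.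
have s_in : 0 <= s <= len e by lra.
have hs : h (chart e s) = r.
  by rewrite he// /F eqxx subrr normr0 subr0; apply/max_idPr; lra.
move=> x; have := hL (chart e s) x; rewrite hs.
have [[v ->]|[e' [t [te ->]]]] := chart_cover G x.
  by rewrite hv subr0 gtr0_norm// => ?; right.
have te' : 0 <= t <= len e' by lra.
rewrite (he _ _ te') /F; have [E|_] := eqVneq e' e; last first.
  by rewrite subr0 gtr0_norm// => ?; right.
subst e'; have := mdist_chart_le s_in te'.
have [st|st] := ltP `|s - t| r.
  move=> d1; rewrite max_r; last lra.
  rewrite opprB addrC subrK normr_id => d2.
  by left; exists t; split=> //; split=> //; apply/eqP; rewrite eq_le d1 d2.
by rewrite max_l; [rewrite subr0 (gtr0_norm r0) => _ ?; right|lra].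
Qed.

(** By the last two hypotheses the tent of radius [|s - t|] around [s] fits in the edge; the point
    at [t] is on its rim, so it falls under the second alternative of [tent]. Far from [s], a path
    through other edges could be shorter. *)
Lemma mdist_chart e (s t : R) : 0 < s < len e -> 0 <= t <= len e ->
  `|s - t| <= s -> `|s - t| <= len e - s -> mdist (chart e s) (chart e t) = `|s - t|.
Proof.
move=> se te d1 d2; have [<-|st] := eqVneq s t.
  by rewrite mdistxx subrr normr0.
have r0 : 0 < `|s - t| by rewrite normr_gt0 subr_eq0.
apply/eqP; rewrite eq_le mdist_chart_le//=; last by lra.
have [||[u [ur ue [xu _]]]|//] := @tent e s `|s - t| r0 _ _ (chart e t) => //; first lra.
exfalso; move/chart_end: te => [E|E|te]; last first.
- by have [_ E] := chart_inj te ue xu; rewrite E ltxx in ur.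
- by rewrite E chart_tgt in xu; exact: (chart_vtx ue (esym xu)).
- by rewrite E chart_src in xu; exact: (chart_vtx ue (esym xu)).
Qed.

End ModelMetric.

(** * Refinements of models; invariance of valence, order and sections *)

Section Refinement.
Context {R : realType} {X : metricType R}.

Definition half_edge_map (G N : model X) (ed : edge N -> edge G)
    (off : edge N -> R) (h : half_edge N) : half_edge G :=
  (ed h.1.1, h.1.2, off h.1.1 + h.2).

(* The edge [e] of [N] is the segment of [ed e] starting at [off e]; asking for
   the equality of charts at all [s] makes the slopes along [e] and [ed e] equal
   by congruence, also at the ends. *)
Definition refines (G N : model X) : Prop :=
  [/\ genus N = genus G,
    forall f, piecewise_linear N f -> piecewise_linear G f &
    exists (ed : edge N -> edge G) (off : edge N -> R),
      (forall e s, chart e s = chart (ed e) (off e + s)) /\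
      forall x, set_bij (half_edge_at (G := N) x) (half_edge_at (G := G) x)
                        (half_edge_map ed off)].

Lemma refines_refl (G : model X) : refines G G.
Proof.
split=> //; exists id, (fun=> 0); split=> [e s|x]; first by rewrite add0r.
have -> : half_edge_map (G := G) id (fun=> 0) = id.
  by apply/funext => -[[e b] s]; rewrite /half_edge_map /= add0r.
by split=> [h|h h' _ _|h hx] //; exists h.
Qed.

Lemma refines_trans (G M N : model X) : refines G M -> refines M N -> refines G N.
Proof.
move=> [g1 pl1 [ed1 [off1 [ch1 bij1]]]] [g2 pl2 [ed2 [off2 [ch2 bij2]]]].
split; [by rewrite g2|by move=> f /pl2/pl1|].
exists (ed1 \o ed2), (fun e => off1 (ed2 e) + off2 e); split=> [e s|x].
  by rewrite ch2 ch1 addrA.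
have -> : half_edge_map (ed1 \o ed2) (fun e => off1 (ed2 e) + off2 e) =
    half_edge_map ed1 off1 \o half_edge_map (G := M) ed2 off2.
  by apply/funext => -[[e b] s]; rewrite /half_edge_map /= addrA.
exact: set_bij_comp (bij2 x) (bij1 x).
Qed.

Lemma refines_slope (G N : model X) ed off (f : X -> R) (h : half_edge N) :
  (forall e s, chart e s = chart (ed e) (off e + s)) ->
  slope f h = slope f (half_edge_map (G := G) ed off h).
Proof.
move=> ch; rewrite /slope; congr xget; apply/funext => k.
have hE r : half_edge_point h r = half_edge_point (half_edge_map (G := G) ed off h) r.
  by rewrite /half_edge_point /= ch; case: ifP => _; rewrite addrA.
by apply/propext; split=> -[eps eps0 P]; exists eps => // r /P; rewrite !hE.
Qed.

(** Even on a loop, whose two ends are the same point, the direction decides the parameter: 0 occurs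
    only with the increasing germ and [len e] only with the decreasing one. *)
Lemma half_edge_at_inj (G : model X) x :
  {in half_edge_at (G := G) x &, injective (fun h : half_edge G => h.1)}.
Proof.
move=> [[e b] s] [[e' b'] t] /set_mem[/= xs sb] /set_mem[/= xt tb] [E1 E2].
subst e' b'; congr (_, _, _).
have : 0 <= s <= len e by case: ifP sb => _ ?; lra.
have : 0 <= t <= len e by case: ifP tb => _ ?; lra.
move=> /chart_end te /chart_end se.
move: xt; rewrite -xs; case: te sb tb => [->|->|te]; case: se => [->|->|se] //=;
  rewrite ?chart_src ?chart_tgt ?lexx ?ltxx ?andbF //; try by case: ifP.
- by move=> _ _ /esym/(chart_vtx se).
- by move=> _ _ /esym/(chart_vtx se).
- by move=> _ _ /(chart_vtx te).
- by move=> _ _ /(chart_vtx te).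
- by move=> _ _ /(chart_inj te se)[].
Qed.

Lemma half_edge_at_finite (G : model X) x : finite_set (half_edge_at (G := G) x).
Proof.
have <- : finite_set ((fun h : half_edge G => h.1) @` half_edge_at (G := G) x) =
    finite_set (half_edge_at (G := G) x).
  exact: eq_finite_set (inj_card_eq (@half_edge_at_inj G x)).
exact: finite_finset.
Qed.

Lemma refines_valence (G N : model X) : refines G N -> valence N = valence G.
Proof.
move=> [_ _ [ed [off [_ bij]]]]; apply/funext => x; rewrite /valence.
have /finite_setP[k Nk] := half_edge_at_finite N x.
rewrite (card_fset_set Nk); apply/esym/card_fset_set.
have [bfun binj bsurj] := bij x.
have <- : half_edge_map ed off @` half_edge_at (G := N) x = half_edge_at (G := G) x.
  by apply/seteqP; split=> [_ [h hx <-]|h /bsurj[h' hx <-]]; [exact: bfun|exists h'].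
by rewrite (card_eql (inj_card_eq binj)).
Qed.

Lemma refines_ord (G N : model X) : refines G N -> forall f, ord N f = ord G f.
Proof.
move=> [_ _ [ed [off [ch bij]]]] f; apply/funext => x; rewrite /ord.
rewrite (reindex_fsbig _ _ _ _ (bij x)).
by apply: eq_fsbigr => h _; exact: refines_slope.
Qed.

(** Allows sections to be constructed on whichever refinement suits the construction. *)
Lemma refines_sections (G N : model X) : refines G N -> forall f,
  sections N (canonical_div N) f -> sections G (canonical_div G) f.
Proof.
move=> GN f [->|[g [[gc gpl] geff] ->]]; first by left.
right; exists g => //; split.
  by split=> //; have [_ pl _] := GN; exact: pl.
by move=> x; rewrite /canonical_div -(refines_valence GN) -(refines_ord GN); exact: geff.
Qed.

End Refinement.

(** * Subdivision of models *)

Section Subdivision.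
Context {R : realType} {X : metricType R} (G : model X).
Variables (e1 : edge G) (t0 : R).
Hypothesis t0P : 0 < t0 < len e1.

(** The edge [Some e1] is cut down to the first part of [e1], ending at the new vertex [None]; the
    edge [None] is the second part. *)
Definition subdivided_graph : graph := {|
  vertex := option (vertex G);
  edge := option (edge G);
  src := fun e => if e is Some e then Some (src e) else None;
  tgt := fun e => if e is Some e then if e == e1 then None else Some (tgt e)
                  else Some (tgt e1) |}.

Local Notation T := subdivided_graph.

Definition subdivided_edge (e : edge T) : edge G := if e is Some e then e else e1.
Definition subdivided_offset (e : edge T) : R := if e is Some _ then 0 else t0.
Definition subdivided_len (e : edge T) : R :=
  if e is Some e then if e == e1 then t0 else len e else len e1 - t0.
Definition subdivided_vtx (v : vertex T) : X :=
  if v is Some v then vtx v else chart e1 t0.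
Definition subdivided_chart (e : edge T) (s : R) : X :=
  chart (subdivided_edge e) (subdivided_offset e + s).

Lemma subdivided_connected : connected_graph T.
Proof.
have [V0 GC] := gr_connected G; split; first by rewrite card_option.
have sym : connect_sym (@Defs.adjacent T).
  by apply: sym_connect_sym => u v; apply: eq_existsb => e; rewrite orbC.
have edgeC (e : edge T) : connect (@Defs.adjacent T) (src e) (tgt e).
  by apply: connect1; apply/existsP; exists e; rewrite !eqxx.
have edgeG (e : edge G) : connect (@Defs.adjacent T) (Some (src e)) (Some (tgt e)).
  have := edgeC (Some e); rewrite /=; case: eqP => // -> h.
  exact: connect_trans h (edgeC None).
have someC u v : connect (@Defs.adjacent T) (Some u) (Some v).
  have /connectP[p] := GC u v; elim: p u => [|w p IH] u /=; first by move=> _ ->.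
  move=> /andP[/existsP[e /orP[]/andP[/eqP <- /eqP <-]] pp lp].
    exact: connect_trans (edgeG e) (IH _ pp lp).
  by apply: connect_trans (IH _ pp lp); rewrite sym.
have noneC v : connect (@Defs.adjacent T) None (Some v).
  exact: connect_trans (edgeC None) (someC _ _).
by case=> [u|] [v|] //; rewrite sym.
Qed.

Lemma subdivided_len_gt0 e : 0 < subdivided_len e.
Proof.
have t0_in := t0P.
by case: e => [e|] /=; [case: eqP => _; [lra|exact: len_gt0]|lra].
Qed.

Lemma subdivided_chart_src e : subdivided_chart e 0 = subdivided_vtx (src e).
Proof.
by case: e => [e|]; rewrite /subdivided_chart /= addr0 ?chart_src.
Qed.

Lemma subdivided_chart_tgt e :
  subdivided_chart e (subdivided_len e) = subdivided_vtx (tgt e).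
Proof.
case: e => [e|]; rewrite /subdivided_chart /= ?add0r.
  by case: eqP => [->//|_]; exact: chart_tgt.
by rewrite addrC subrK chart_tgt.
Qed.

Lemma subdivided_vtx_inj : injective subdivided_vtx.
Proof.
case=> [u|] [v|] //=; first by move=> /vtx_inj ->.
  by move=> /esym/(chart_vtx t0P).
by move=> /(chart_vtx t0P).
Qed.

Lemma subdivided_itv e s : 0 < s < subdivided_len e ->
  0 < subdivided_offset e + s < len (subdivided_edge e).
Proof.
have t0_in := t0P.
by case: e => [e|] /=; [case: eqP => [->|_]; rewrite add0r => ?; lra|lra].
Qed.

Lemma subdivided_chart_inj e e' s t :
  0 < s < subdivided_len e -> 0 < t < subdivided_len e' ->
  subdivided_chart e s = subdivided_chart e' t -> e = e' /\ s = t.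
Proof.
have t0_in := t0P.
move=> sP tP /(chart_inj (subdivided_itv sP) (subdivided_itv tP)).
case: e e' sP tP => [e|] [e'|] /=.
- by move=> _ _ []; rewrite !add0r => -> ->.
- by case: eqP => [_|/eqP/negbTE ne] ? ? [E]; [lra|rewrite E eqxx in ne].
- by case: eqP => [_|/eqP/negbTE ne] ? ? [E]; [lra|rewrite E eqxx in ne].
- by move=> _ _ [_ /addrI ->].
Qed.

Lemma subdivided_chart_vtx e s v : 0 < s < subdivided_len e ->
  subdivided_chart e s <> subdivided_vtx v.
Proof.
have t0_in := t0P.
move=> sP; case: v => [v|] /=; first exact: chart_vtx (subdivided_itv sP).
move=> /(chart_inj (subdivided_itv sP) t0P).
case: e sP => [e|] /=; last by move=> ? [_]; lra.
by case: eqP => [_|ne] ? [E]; [lra|].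
Qed.

Lemma subdivided_cover x : (exists v, x = subdivided_vtx v) \/
  (exists e s, 0 < s < subdivided_len e /\ x = subdivided_chart e s).
Proof.
have t0_in := t0P.
have [[v ->]|[e [s [sP ->]]]] := chart_cover G x; first by left; exists (Some v).
have [E|/eqP ne] := eqVneq e e1; last first.
  by right; exists (Some e), s; rewrite /subdivided_chart /= add0r; case: eqP.
subst e; have [st|ts|->] := ltgtP s t0; last by left; exists None.
  right; exists (Some e1), s; rewrite /subdivided_chart /= add0r eqxx; split=> //; lra.
right; exists None, (s - t0); rewrite /subdivided_chart /= (addrC t0) subrK; split=> //; lra.
Qed.

Local Notation stepG := (edge_step (@len _ _ G) (@chart _ _ G)).
Local Notation stepT := (edge_step subdivided_len subdivided_chart).

(** A segment of [e1] straddling [t0] splits there into two with the same total length, and every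
    segment of the subdivision is already one of [G]. *)
Lemma subdivided_chain x y L : chain stepG x y L <-> chain stepT x y L.
Proof.
have t0_in := t0P.
split; elim=> [{}x|{}x {}y z a b].
- exact: chain_nil.
- move=> xy _; suff : chain stepT x y a by exact: chain_cat.
  have one e (s t : R) : 0 <= s <= subdivided_len e -> 0 <= t <= subdivided_len e ->
      chain stepT (subdivided_chart e s) (subdivided_chart e t) `|s - t|.
    move=> sP tP; rewrite -(addr0 `|s - t|).
    by apply: chain_cons (chain_nil _ _); exists e, s, t.
  have lo s t : 0 <= s <= t0 -> 0 <= t <= t0 ->
      chain stepT (chart e1 s) (chart e1 t) `|s - t|.
    by have := one (Some e1) s t; rewrite /subdivided_chart /= eqxx !add0r.
  have hi s t : t0 <= s <= len e1 -> t0 <= t <= len e1 ->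
      chain stepT (chart e1 s) (chart e1 t) `|s - t|.
    move=> ? ?; have := one None (s - t0) (t - t0).
    rewrite /subdivided_chart /= !(addrC t0) !subrK opprB addrA subrK.
    by apply; lra.
  case: xy => e [s [t [sP tP <- <- ->]]].
  have [E|ne] := eqVneq e e1; last first.
    have := one (Some e) s t; rewrite /subdivided_chart /= (negbTE ne) !add0r.
    exact.
  subst e; have [st|st] := leP s t0; have [tt|tt] := leP t t0.
  + by apply: lo; lra.
  + have -> : `|s - t| = `|s - t0| + `|t0 - t|.
      by rewrite !ler0_norm; lra.
    by apply: (@chain_cat _ _ _ _ (chart e1 t0)); [apply: lo|apply: hi]; lra.
  + have -> : `|s - t| = `|s - t0| + `|t0 - t|.
      by rewrite !ger0_norm; lra.
    by apply: (@chain_cat _ _ _ _ (chart e1 t0)); [apply: hi|apply: lo]; lra.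
  + by apply: hi; lra.
- exact: chain_nil.
- move=> [e [s [t [sP tP <- <- ->]]]] _; apply: chain_cons.
  exists (subdivided_edge e), (subdivided_offset e + s), (subdivided_offset e + t).
  split=> //; last by rewrite opprD addrACA subrr add0r.
    by case: e sP {tP} => [e|] /=; [case: eqP => [->|_]|]; lra.
  by case: e tP {sP} => [e|] /=; [case: eqP => [->|_]|]; lra.
Qed.

Lemma subdivided_dist x y : mdist x y = chain_dist stepT x y.
Proof.
rewrite (model_dist G) /chain_dist; congr inf.
by apply/seteqP; split=> L /=; rewrite subdivided_chain.
Qed.

Definition subdivision : model X := Model subdivided_connected subdivided_len_gt0
  subdivided_chart_src subdivided_chart_tgt subdivided_vtx_inj subdivided_chart_inj
  subdivided_chart_vtx subdivided_cover subdivided_dist.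

Lemma subdivision_vtx x : (exists v : vertex subdivision, x = vtx v) <->
  (exists v : vertex G, x = vtx v) \/ x = chart e1 t0.
Proof.
split=> [[[v|] ->]|[[v ->]|->]]; [by left; exists v|by right|by exists (Some v)|].
by exists None.
Qed.

Lemma subdivision_piecewise_linear f :
  piecewise_linear subdivision f -> piecewise_linear G f.
Proof.
have t0_in := t0P.
move=> pl e; have [E|ne] := eqVneq e e1; last first.
  have [brk P] := pl (Some e); exists brk => s t s0 st tl nb.
  have := P s t s0 st; rewrite /= (negbTE ne) => /(_ tl nb)[k kP].
  by exists k => r /kP; rewrite /subdivided_chart /= !add0r.
subst e; have [b1 P1] := pl (Some e1); have [b2 P2] := pl None.
(* With [t0] as a break point, a break-free interval lies in one of the two parts; the break points
   of the second part are shifted to the parameter of [e1]. *)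
exists (t0 :: b1 ++ map (+%R t0) b2) => s t s0 st tl nb.
have [ts|ts] := leP t t0.
  have := P1 s t s0 st; rewrite /= eqxx => /(_ ts)[].
    by move=> r rb; apply: nb; rewrite inE mem_cat rb /= orbT.
  by move=> k kP; exists k => r /kP; rewrite /subdivided_chart /= !add0r.
have t0s : t0 <= s.
  by have := nb t0; rewrite mem_head ts andbT -leNgt; exact.
have [|||r rb|k kP] := P2 (s - t0) (t - t0); rewrite /=; try lra.
  have := nb (t0 + r); rewrite inE mem_cat map_f// !orbT => /(_ isT).
  by apply: contra; lra.
exists k => r rP; have := kP (r - t0); rewrite /= /subdivided_chart /=.
rewrite !(addrC t0) !subrK opprB addrA subrK; apply; lra.
Qed.

Lemma subdivision_half_edges x : set_bij (half_edge_at (G := subdivision) x)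
  (half_edge_at (G := G) x) (half_edge_map (G := G) (N := subdivision) subdivided_edge subdivided_offset).
Proof.
have t0_in := t0P.
split.
- move=> [[e b] s] [/= xs sP]; split=> //=.
  by case: e b {xs} sP => [e|] [] /=; try (case: eqP => [->|_]); lra.
{ move=> h h' /set_mem hx /set_mem hx' E; apply: (@half_edge_at_inj _ _ subdivision x); try exact: mem_set.
  case: h h' hx hx' E => -[e b] s [[e' b'] s'] [/= _ sP] [/= _ sP'] [].
  case: e e' b b' sP sP' => [e|] [e'|] [] [] //=; rewrite ?eqxx.
  all: try by move=> _ _ ->.
  all: move=> hs hs' E1 _ E2; exfalso; move: hs hs' E2.
  + by rewrite E1 eqxx /=; lra.
  + by rewrite E1 eqxx /=; lra.
  + by rewrite -E1 eqxx /=; lra.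
  + by rewrite -E1 eqxx /=; lra. }
move=> [[e b] s] [/= xs sP].
have [E|ne] := eqVneq e e1; last first.
  exists (Some e, b, s); last by rewrite /half_edge_map /= add0r.
  by split=> /=; rewrite /subdivided_chart /= ?add0r// (negbTE ne).
(* At [s = t0] the increasing germ begins the second part and the decreasing germ ends the first,
   whence one strict and one weak inequality. *)
subst e; have [lo|hi] := boolP (if b then s < t0 else s <= t0).
  exists (Some e1, b, s); last by rewrite /half_edge_map /= add0r.
  split=> /=; rewrite /subdivided_chart /= ?add0r// eqxx.
  by case: b lo sP => /=; lra.
exists (None, b, s - t0); last by rewrite /half_edge_map /= (addrC t0) subrK.
split=> /=; first by rewrite /subdivided_chart /= (addrC t0) subrK.
by case: b hi sP => /=; lra.
Qed.

Lemma subdivision_refines : refines G subdivision.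
Proof.
split; last by exists subdivided_edge, subdivided_offset; split=> // x;
  exact: subdivision_half_edges.
  by rewrite /genus /betti /= !card_option subSS.
exact: subdivision_piecewise_linear.
Qed.

End Subdivision.

(** Subdivides at the points of [l] that are not yet vertices. The vertices are described exactly,
    so that refinements of [X] and of its quotient can be matched. *)
Lemma refinement_exists (R : realType) (X : metricType R) (G : model X) (l : seq X) :
  exists2 N : model X, refines G N &
    forall x, (exists v : vertex N, x = vtx v) <->
      (exists v : vertex G, x = vtx v) \/ x \in l.
Proof.
elim: l => [|y l [N GN NP]].
  by exists G => [|x]; [exact: refines_refl|split=> [|[]//]; left].
have [yN|[e [s [sP yE]]]] := chart_cover N y.
  exists N => // x; rewrite inE; split=> [/NP[|xl]|[xG|/orP[/eqP ->//|xl]]].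
  - by left.
  - by right; rewrite xl orbT.
  - by apply/NP; left.
  - by apply/NP; right.
exists (subdivision sP); first exact: refines_trans GN (subdivision_refines _).
move=> x; rewrite subdivision_vtx NP -yE inE; split.
  by case=> [[|->]|->]; [left|right; rewrite orbT|right; rewrite eqxx].
by case=> [|/orP[/eqP ->|]]; [do 2 left|right|left; right].
Qed.

(** * Submetries between models *)

(** Connectedness of the interval: the supremum of the parameters up to which [g] keeps its value at
    [s] could otherwise be pushed further. *)
Lemma locally_constant (R : realType) (T : Type) (g : R -> T) (a b : R) :
  (forall s, a < s < b -> exists2 r : R, 0 < r &
     forall s', a < s' < b -> `|s' - s| < r -> g s' = g s) ->
  forall s t, a < s < b -> a < t < b -> g s = g t.
Proof.
move=> loc; suff lt s t : a < s < b -> a < t < b -> s < t -> g s = g t.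
  by move=> s t sP tP; have [/lt->|/lt->|->] := ltgtP s t.
move=> sP tP st; pose A := [set u | s <= u <= t /\ forall v, s <= v <= u -> g v = g s].
have As : A s by split=> [|v ?]; [lra|congr g; lra].
have A0 : A !=set0 by exists s.
have supA : has_sup A by split=> //; exists t => u [/andP[]].
have sm : s <= sup A by apply: ub_le_sup => //; case: supA.
have mt : sup A <= t by apply: ge_sup => // u [/andP[]].
have mP : a < sup A < b by lra.
have [r r0 rP] := loc _ mP.
have [u [uP gu] mu] := sup_adherent r0 supA.
have um : u <= sup A by apply: ub_le_sup; [case: supA|split].
have gm : g (sup A) = g s.
  have us : g u = g s by apply: gu; lra.
  rewrite -us; apply/esym/rP; first by lra.
  by rewrite ler0_norm; lra.
(* This [w] stays within reach of the local constancy at [sup A], so it belongs to [A]; unless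
   [w = t] it exceeds [sup A]. *)
pose w := Num.min t (sup A + r / 2).
have wt : w <= t by rewrite ge_min lexx.
have wm : w <= sup A + r / 2 by rewrite ge_min lexx orbT.
have mw : sup A <= w by rewrite le_min mt /=; lra.
have Aw : A w.
  split=> [|v vP]; first by lra.
  have [vu|uv] := leP v u; first by apply: gu; lra.
  by rewrite rP ?gm// ?ltr_norml; lra.
have : w <= sup A by apply: ub_le_sup => //; case: supA.
rewrite ge_min => /orP[tm|wm']; last by exfalso; lra.
have -> : t = sup A by apply/eqP; rewrite eq_le tm mt.
by rewrite gm.
Qed.

(** Pointwise uniqueness turns the local witnesses into a locally constant function [g] of the
    parameter. *)
Lemma local_constancy (R : realType) (T : Type) (Q : T -> R -> Prop) (a b : R) :
  (forall s, a < s < b -> exists2 r : R, 0 < r & exists tau, forall s',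
     a < s' < b -> `|s' - s| < r -> Q tau s') ->
  (forall s tau tau', Q tau s -> Q tau' s -> tau = tau') ->
  a < b -> exists tau, forall s, a < s < b -> Q tau s.
Proof.
move=> loc uniq ab; have mid : a < (a + b) / 2 < b by lra.
have [_ _ [tau0 _]] := loc _ mid.
pose Q' s : set {classic T} := [set tau : {classic T} | Q tau s].
pose g s := xget (tau0 : {classic T}) (Q' s).
have gE s tau : Q tau s -> g s = tau.
  by move=> q; apply: (uniq s) => //; exact: (@xgetPex _ _ (Q' s) (ex_intro _ tau q)).
exists (g ((a + b) / 2)) => s sP.
have -> : g ((a + b) / 2) = g s.
  apply: (locally_constant (a := a) (b := b)) => // u uP.
  have [r r0 [tau P]] := loc u uP; exists r => // u' u'P uu'.
  by rewrite (gE _ _ (P u' u'P uu')) (gE u tau)//; apply: P; rewrite ?subrr ?normr0.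
have [r r0 [tau P]] := loc s sP.
have q : Q tau s by apply: P; rewrite ?subrr ?normr0.
by rewrite (gE _ _ q).
Qed.

Section Submetry.
Context {R : realType} {X Y : metricType R} (G : model X) (H : model Y) (p : X -> Y).
Hypothesis p_short : forall x x', mdist (p x) (p x') <= mdist x x'.
Hypothesis p_lift : forall x y,
  exists2 x', p x' = y & mdist x x' = mdist (p x) y.
Hypothesis p_vtx : forall x,
  (exists v : vertex G, x = vtx v) <-> (exists w : vertex H, p x = vtx w).

Definition affine_pos (b : bool) (c s : R) : R := if b then c + s else c - s.

Lemma interior_vtx (e : edge G) (s : R) : 0 < s < len e ->
  exists (e' : edge H) (t : R), 0 < t < len e' /\ p (chart e s) = chart e' t.
Proof.
move=> sP; have [/p_vtx[v xs]|//] := chart_cover H (p (chart e s)).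
by have := chart_vtx sP xs.
Qed.

(* A short map lifting distances sends the interval of radius [r] around [s]
   onto the interval of radius [r] around the image point, so it is an
   isometry there. *)
Lemma submetry_local (e : edge G) (s : R) : 0 < s < len e ->
  exists2 r : R, 0 < r & exists tau : edge H * bool * R, forall s',
    `|s' - s| < r -> 0 < affine_pos tau.1.2 tau.2 s' < len tau.1.1 /\
      p (chart e s') = chart tau.1.1 (affine_pos tau.1.2 tau.2 s').
Proof.
move=> sP; have [e' [t [tP pst]]] := interior_vtx sP.
(* The margin [4 * r] leaves room for tents of radius [2 * r] around [s] and [t], and for distances
   up to [2 * r] measured from any point within [r] of [t]. *)
have [r [r0 [rs [rl [rt rl']]]]] : exists r : R, [/\ 0 < r, 4 * r <= s &
    4 * r <= len e - s /\ 4 * r <= t /\ 4 * r <= len e' - t].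
  exists (Num.min (Num.min s (len e - s)) (Num.min t (len e' - t)) / 4).
  set m := Num.min (Num.min _ _) _; have m0 : 0 < m by rewrite !lt_min; lra.
  have [m1 m2 m3 m4] : [/\ m <= s, m <= len e - s, m <= t & m <= len e' - t].
    by rewrite /m; split; rewrite !ge_min lexx ?orbT.
  clearbody m; split; [lra|lra|split]; first lra.
  by split; lra.
have img s' : `|s' - s| <= r -> exists t', [/\ 0 < t' < len e', `|t - t'| <= `|s' - s|,
    p (chart e s') = chart e' t' & mdist (chart e' t) (chart e' t') = `|t - t'|].
  move=> s's; have s'P : 0 <= s' <= len e by rewrite ler_norml in s's; lra.
  have sP' : 0 <= s <= len e by lra.
  have d : mdist (chart e' t) (p (chart e s')) <= `|s' - s|.
    by rewrite -pst (le_trans (p_short _ _))// distrC mdist_chart_le.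
  have r20 : 0 < 2 * r by lra.
  have r2t : 2 * r <= t by lra.
  have r2l : t + 2 * r <= len e' by lra.
  have [[t' [_ t'P [E dE]]]|] := tent r20 r2t r2l (p (chart e s')); last by lra.
  by rewrite E in d dE *; exists t'; rewrite -dE.
have ends t1 : `|t - t1| = r -> exists2 s1, `|s - s1| = r & p (chart e s1) = chart e' t1.
  move=> tt1; have [x' px' xx'] := p_lift (chart e s) (chart e' t1).
  have t1P : 0 <= t1 <= len e' by have := ler_norm (t - t1); have := ler_norm (t1 - t); rewrite (distrC t1 t); lra.
  have r20 : 0 < 2 * r by lra.
  have r2t : 2 * r <= s by lra.
  have r2l : s + 2 * r <= len e by lra.
  rewrite pst mdist_chart// ?tt1 in xx'; [|by lra|by lra].
  have [[s1 [_ _ [E dE]]]|] := tent r20 r2t r2l x'; last by lra.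
  by exists s1; rewrite -?E// -dE xx'.
have two s1 : `|s - s1| = r -> s1 = s + r \/ s1 = s - r.
  have [d|d] := leP 0 (s - s1); rewrite ?(ger0_norm d) ?(ltr0_norm d) => ?.
    by right; lra.
  by left; lra.
(* The two points at distance [r] from [t] lift to points at distance [r] from [s]. The lifts are
   distinct, so they are the two sides of [s]; their order defines [b]. *)
have [b [pb1 pb2]] : exists b : bool,
    p (chart e (s + r)) = chart e' (if b then t + r else t - r) /\
    p (chart e (s - r)) = chart e' (if b then t - r else t + r).
  have [|s1 /two s1E ps1] := ends (t + r); first by rewrite ler0_norm; lra.
  have [|s2 /two s2E ps2] := ends (t - r); first by rewrite ger0_norm; lra.
  have ne : s1 <> s2.
    move=> E; rewrite E ps2 in ps1.
    have t1P : 0 < t - r < len e' by lra.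
    have t2P : 0 < t + r < len e' by lra.
    by have [_] := chart_inj t1P t2P ps1; lra.
  case: s1E s2E => E1 [] E2; subst s1 s2; [by []|by exists true|by exists false|by []].
exists r => //; exists (e', b, if b then t - s else t + s) => s' s's.
have [t' [t'P tt' pst' _]] := img s' (ltW s's).
have s'P : 0 <= s' <= len e by rewrite ltr_norml in s's; lra.
(* Applied to both ends of an interval of length [2 * r], these bounds leave a single possible
   position for [t']. *)
have near t1 s1 : `|t - t1| = r -> `|s - s1| = r -> p (chart e s1) = chart e' t1 ->
    `|t' - t1| <= `|s' - s1|.
  move=> tt1 ss1 ps1.
  have s1P : 0 <= s1 <= len e by case: (two s1 ss1); lra.
  have t1P : 0 <= t1 <= len e'.
    by have := ler_norm (t - t1); have := ler_norm (t1 - t); rewrite (distrC t1 t); lra.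
  have d2 : `|t' - t1| <= 2 * r.
    by rewrite (le_trans (ler_distD t _ _))// tt1 distrC; lra.
  have t'b : t - r <= t' <= t + r.
    by rewrite -ler_distl distrC; lra.
  rewrite -(@mdist_chart _ _ _ e' t' t1)//; [|by lra|by lra].
  by rewrite -pst' -ps1 (le_trans (p_short _ _))// mdist_chart_le.
rewrite pst'; have t1E : `|t - (t + r)| = r by rewrite ler0_norm; lra.
have t2E : `|t - (t - r)| = r by rewrite ger0_norm; lra.
have s1E : `|s - (s + r)| = r by rewrite ler0_norm; lra.
have s2E : `|s - (s - r)| = r by rewrite ger0_norm; lra.
rewrite ltr_norml in s's.
suff -> : affine_pos b (if b then t - s else t + s) s' = t' by [].
case: b pb1 pb2 => pb1 pb2; rewrite /affine_pos.
  have := near _ _ t1E s1E pb1; have := near _ _ t2E s2E pb2.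
  by rewrite !ler_norml (ler0_norm (x := s' - (s + r))) ?(ger0_norm (x := s' - (s - r))); lra.
have := near _ _ t1E s2E pb2; have := near _ _ t2E s1E pb1.
by rewrite !ler_norml (ler0_norm (x := s' - (s + r))) ?(ger0_norm (x := s' - (s - r))); lra.
Qed.

Lemma submetry_edge_interior (e : edge G) : exists tau : edge H * bool * R,
  forall s : R, 0 < s < len e -> 0 < affine_pos tau.1.2 tau.2 s < len tau.1.1 /\
      p (chart e s) = chart tau.1.1 (affine_pos tau.1.2 tau.2 s).
Proof.
(* Validity is required on a neighbourhood: a single point does not determine both direction and
   offset, but the two points [s] and [s + u] do. *)
pose Q (tau : edge H * bool * R) s := exists2 r : R, 0 < r & forall s',
    `|s' - s| < r -> 0 < affine_pos tau.1.2 tau.2 s' < len tau.1.1 /\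
      p (chart e s') = chart tau.1.1 (affine_pos tau.1.2 tau.2 s').
have [s sP|s tau tau' [r r0 rP] [r' r'0 r'P]||tau tauP] :=
    @local_constancy R _ Q 0 (len e).
- have [r r0 [tau P]] := submetry_local sP.
  exists (r / 2); first by lra.
  exists tau => s' _ s's; exists (r / 2); first by lra.
  move=> s'' s''s'; apply: P; rewrite (le_lt_trans (ler_distD s' _ _))//.
  by rewrite (splitr r) ltrD.
- have [u [u0 ur ur']] : exists u, [/\ 0 < u, u < r & u < r'].
    by exists (Num.min r r' / 2); case: (leP r r') => ?; split; lra.
  have near v : v = s \/ v = s + u -> tau.1.1 = tau'.1.1 /\
      affine_pos tau.1.2 tau.2 v = affine_pos tau'.1.2 tau'.2 v.
    move=> vE; have vs : `|v - s| <= u.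
      by case: vE => ->; rewrite ?subrr ?normr0 ?(addrC s) ?addrK ?gtr0_norm//; lra.
    have [i1 E1] := rP v (le_lt_trans vs ur).
    have [i2 E2] := r'P v (le_lt_trans vs ur').
    by apply: chart_inj i1 i2 _; rewrite -E1 -E2.
  have [E1 E2] := near s (or_introl erefl).
  have [_ E3] := near (s + u) (or_intror erefl).
  clear rP r'P near; case: tau tau' E1 E2 E3 => -[e1 b] c [[e2 b'] c'] /= -> E2 E3.
  have [E4 E5] : b = b' /\ c = c'.
    by move: E2 E3; rewrite /affine_pos; case: b b' => -[] ? ?; split => //; lra.
  by rewrite E4 E5.
- exact: len_gt0.
exists tau => s /tauP[r r0 P]; apply: P; by rewrite subrr normr0.
Qed.

(** The ends of [e] are vertices, so by [p_vtx] they cannot land in the interior of [e']; this pins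
    down the offset and makes both lengths equal. *)
Lemma submetry_dilates (e : edge G) : exists (e' : edge H) (b : bool), dilates p e e' b 1.
Proof.
have l0 := len_gt0 e; have [[[e' b] c] /= tP] := submetry_edge_interior e.
have l'0 := len_gt0 e'.
have aff s s' : `|affine_pos b c s - affine_pos b c s'| = `|s - s'|.
  rewrite /affine_pos; case: b {tP} => /=; first by congr `|_|; lra.
  by rewrite distrC; congr `|_|; lra.
(* Both charts are continuous, so the formula persists at the ends. *)
have closed (s : R) : 0 <= s <= len e -> 0 <= affine_pos b c s <= len e' /\
    p (chart e s) = chart e' (affine_pos b c s).
  move=> sP.
  have approx d : 0 < d -> exists2 s', 0 < s' < len e & `|s - s'| <= d.
    move=> d0; have [eta [eta0 etad etal]] : exists eta : R,
        [/\ 0 < eta, eta <= d & eta <= len e / 4].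
      by exists (Num.min d (len e / 4)); rewrite lt_min !ge_min !lexx orbT; split=> //; lra.
    have [sl|sl] := leP s (len e / 2).
      by exists (s + eta); [|rewrite ler0_norm]; lra.
    by exists (s - eta); [|rewrite ger0_norm]; lra.
  have range : 0 <= affine_pos b c s <= len e'.
    apply/andP; split; apply/ler_addgt0Pl => d d0; have [s' s'P ss'] := approx d d0;
      have [i _] := tP s' s'P; have := aff s s'; move: ss' => /[swap] <-;
      rewrite ler_norml; lra.
  split=> //; apply: mdist_positivity; apply/eqP; rewrite eq_le mdist_ge0 andbT.
  apply/ler_addgt0Pl => d d0; rewrite addr0.
  have [s' s'P ss'] := approx (d / 2) (divr_gt0 d0 (ltr0n _ 2)).
  have [i E] := tP s' s'P.
  apply: le_trans (metric_triangle _ (p (chart e s')) _) _.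
  rewrite (splitr d) lerD//.
    apply: le_trans (p_short _ _) _; apply: le_trans ss'; apply: mdist_chart_le; lra.
  by rewrite E (le_trans (mdist_chart_le _ _))//; [lra|rewrite distrC aff].
have end_vtx s : s = 0 \/ s = len e ->
    affine_pos b c s = 0 \/ affine_pos b c s = len e'.
  move=> sE; have sP : 0 <= s <= len e by case: sE => ->; lra.
  have [r E] := closed s sP.
  move/chart_end: r => [->|->|r]; [by left|by right|].
  suff /p_vtx[w pw] : exists v : vertex G, chart e s = vtx v.
    by exfalso; apply: (chart_vtx r (v := w)); rewrite -E.
  by case: sE => ->; [exists (src e); exact: chart_src|exists (tgt e); exact: chart_tgt].
have [lE cE] : len e' = len e /\ c = if b then 0 else len e'.
  move: end_vtx; rewrite /affine_pos; case: b {tP aff closed} => h.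
    by have := h 0 (or_introl erefl); have := h _ (or_intror erefl); lra.
  by have := h 0 (or_introl erefl); have := h _ (or_intror erefl); lra.
exists e', b; split=> // [|s sP]; first by rewrite mul1r.
by have [_ ->] := closed s sP; rewrite cE /affine_pos; case: b {cE tP aff closed end_vtx};
  rewrite mul1r ?add0r.
Qed.

End Submetry.

(** * Sections on weighted trees *)

Section Darts.
Variable T : graph.
Implicit Types (d : edge T * bool) (e : edge T) (u v : vertex T).

(** A dart is an edge with a direction, encoded as in half-edges: [true] runs from [src] to
    [tgt]. *)
Definition tail d : vertex T := if d.2 then src d.1 else tgt d.1.
Definition rev_dart d : edge T * bool := (d.1, ~~ d.2).
Definition head d : vertex T := tail (rev_dart d).

Definition adj_in (J : {pred edge T}) : rel (vertex T) := fun u v =>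
  [exists d : edge T * bool, [&& d.1 \in J, tail d == u & head d == v]].

Lemma rev_dartK : involutive rev_dart.
Proof. by case=> e b; rewrite /rev_dart /= negbK. Qed.

Lemma head_rev d : head (rev_dart d) = tail d.
Proof. by rewrite /head rev_dartK. Qed.

Lemma adj_in_sym (J : {pred edge T}) : connect_sym (adj_in J).
Proof.
apply: sym_connect_sym => u v.
by apply/existsP/existsP => -[d /and3P[dJ /eqP <- /eqP <-]];
  exists (rev_dart d); rewrite dJ head_rev !eqxx.
Qed.

Lemma adj_in_closed (J : {pred edge T}) (S : vertex T -> Prop) u v :
  (forall d, d.1 \in J -> S (tail d) -> S (head d)) ->
  connect (adj_in J) u v -> S u -> S v.
Proof.
move=> cl /connectP[p]; elim: p u => [|w p IH] u /=; first by move=> _ ->.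
move=> /andP[/existsP[d /and3P[dJ /eqP <- /eqP <-]] pp lp] Su.
exact: IH pp lp (cl _ dJ Su).
Qed.

Lemma adjacentE : @Defs.adjacent T =2 adj_in predT.
Proof.
move=> u v; apply/existsP/existsP.
  move=> [e /orP[]/andP[eu ev]]; [exists (e, true)|exists (e, false)];
    by rewrite /= /head /tail /= eu ev.
by move=> [[e []] /= /andP[eu ev]]; exists e; rewrite /head /tail /= in eu ev;
  rewrite eu ev ?orbT.
Qed.

(** A largest set [S] containing [r] with at most one more vertex than inner edges is everything: an
    edge of [J] leaving [S] would add one vertex and at least one inner edge. *)
Lemma card_connected (J : {set edge T}) r :
  (forall v, connect (adj_in J) r v) -> (#|vertex T| <= #|J|.+1)%N.
Proof.
move=> conn.
pose inner (S : {set vertex T}) := [set e in J | (src e \in S) && (tgt e \in S)].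
pose P (S : {set vertex T}) := (r \in S) && (#|S| <= #|inner S|.+1)%N.
have P0 : P [set r]%SET by rewrite /P set11 cards1.
case: (arg_maxnP (fun S : {set vertex T} => #|S|) P0) => S /andP[rS cS] maxS.
have [/eqP|] := boolP (S == [set: vertex T]%SET) => [ST|/eqP SnT].
  rewrite -cardsT -ST (leq_trans cS)// ltnS subset_leq_card//.
  by apply/fintype.subsetP => e; rewrite inE => /andP[].
exfalso; apply: SnT; apply/setP => v; rewrite !inE.
apply: (@adj_in_closed _ (fun v => v \in S) _ _ _ (conn v) rS) => d dJ tS; apply: contraT => hS.
have : P (head d |: S)%SET.
  rewrite /P in_setU1 rS orbT /= cardsU1 hS add1n ltnS.
  apply: leq_trans cS _; apply: proper_card; apply/properP; split.
    apply/fintype.subsetP => e; rewrite !inE => /andP[-> /andP[-> ->]].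
    by rewrite !orbT.
  exists d.1; rewrite !inE dJ /=; last first.
    by apply: contra hS; rewrite /head /tail /=; case: (d.2) => /= /andP[].
  move: tS; rewrite /head /tail /=; case: (d.2) => /= ->; by rewrite eqxx ?orbT.
by move=> /maxS /=; rewrite cardsU1 hS add1n ltnn.
Qed.

Definition side d : {set vertex T} := [set v : vertex T | connect (adj_in (predC1 d.1)) (tail d) v].

Lemma tail_side d : tail d \in side d.
Proof. by rewrite inE connect0. Qed.

Lemma side_edge d d' : d'.1 != d.1 -> (tail d' \in side d) = (head d' \in side d).
Proof.
move=> ne; rewrite !inE; apply/idP/idP => h; apply: connect_trans h (connect1 _).
  by apply/existsP; exists d'; rewrite !inE ne !eqxx.
by apply/existsP; exists (rev_dart d'); rewrite !inE /= ne head_rev !eqxx.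
Qed.

Hypothesis T_connected : connected_graph T.
Hypothesis T_betti : betti T = 0%N.

Lemma connected_closed (S : vertex T -> Prop) u v :
  (forall d, S (tail d) -> S (head d)) -> S u -> S v.
Proof.
move=> cl; apply: (@adj_in_closed predT) => [d _|]; first exact: cl.
by rewrite -(eq_connect adjacentE); case: T_connected.
Qed.

Lemma dart_at_exists v : (0 < #|edge T|)%N -> exists d, tail d = v.
Proof.
move=> /card_gt0P[e _]; apply: contrapT => no.
have := @connected_closed (fun u => u = v) v (src e) => /(_ _ erefl) E.
by apply: (no); exists (e, true); apply: E => d dv; exfalso; apply: no; exists d.
Qed.

Lemma card_edges : (#|edge T| < #|vertex T|)%N.
Proof. by move/eqP: T_betti; rewrite subn_eq0. Qed.

(** Otherwise the graph would stay connected without the edge of [d], and [card_connected] would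
    bound the vertices by the number of edges, against [card_edges]. *)
Lemma head_notin_side d : head d \notin side d.
Proof.
apply/negP; rewrite inE => hd.
have : (#|vertex T| <= #|[set~ d.1]%SET|.+1)%N.
  apply: (@card_connected _ (tail d)) => v.
  apply: (@connected_closed (fun v => connect (adj_in (mem [set~ d.1]%SET)) (tail d) v) (tail d));
    last exact: connect0.
  have adjE : adj_in (predC1 d.1) =2 adj_in (mem [set~ d.1]%SET).
    by move=> x y; apply: eq_existsb => d'; rewrite !inE.
  rewrite (eq_connect adjE) in hd.
  move=> d' h; have [E|ne] := eqVneq d'.1 d.1; last first.
    by apply: connect_trans h (connect1 _); apply/existsP; exists d'; rewrite !inE ne !eqxx.
  move: d d' E h hd {adjE} => [e b] [e' b'] /= -> {e'}.
  by case: b b' => -[]; rewrite /head /tail /= => h hd //; exact: connect0.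
rewrite cardsC1 prednK; last by apply/card_gt0P; exists d.1.
by rewrite leqNgt card_edges.
Qed.

(** The two sides cover the connected graph, and a common vertex would join the ends of the edge
    without using it. *)
Lemma side_rev d v : (v \in side (rev_dart d)) = (v \notin side d).
Proof.
have or : v \in side d \/ v \in side (rev_dart d).
  apply: (@connected_closed (fun v => v \in side d \/ v \in side (rev_dart d)) (tail d));
    last by left; exact: tail_side.
  move=> d'; have [E|ne] := eqVneq d'.1 d.1; last first.
    by rewrite (side_edge ne) (@side_edge (rev_dart d) d').
  move=> _; move: d d' E => [e b] [e' b'] /= ->; case: (eqVneq b b') => [->|].
    by right; exact: tail_side.
  case: b b' => -[] // _; by left; exact: tail_side.
case: or => h; rewrite h; last first.
  apply/esym/negP => h'; have := head_notin_side d; rewrite inE => /negP; apply.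
  move: h h'; rewrite !inE /= => h h'; apply: connect_trans h' _.
  by rewrite adj_in_sym.
apply/negP => h'; have := head_notin_side d; rewrite inE => /negP; apply.
move: h h'; rewrite !inE /= => h h'; apply: connect_trans h _.
by rewrite adj_in_sym.
Qed.

Lemma tree_loopless : loopless T.
Proof.
move=> e; apply/eqP => E; have := head_notin_side (e, true).
by rewrite (_ : head (e, true) = tail (e, true)) ?tail_side.
Qed.

(** The dart sought is the first one on the path from [v] to [u]. Its existence propagates from
    vertex to vertex, starting at [v]; crossing it backwards only leads back to [v]. *)
Lemma far_dart_exists u v : u != v -> exists2 d, tail d = v & u \notin side d.
Proof.
move=> uv; pose S x := x = v \/ exists2 d, tail d = v & x \in side (rev_dart d).
have : S u.
  apply: (@connected_closed S v); last by left.
  move=> d' [tv|[d dv h]].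
    by right; exists d' => //; exact: tail_side.
  have [E|ne] := eqVneq d'.1 d.1; last first.
    by right; exists d => //; rewrite -side_edge.
  have [E2|ne] := eqVneq d'.2 d.2.
    have dd : d' = d by rewrite (surjective_pairing d') E E2 -surjective_pairing.
    by exfalso; move: h; rewrite dd side_rev tail_side.
  left; rewrite -dv /head; congr tail; rewrite /rev_dart E [RHS]surjective_pairing.
  by congr pair; move: ne; case: (d'.2) (d.2) => -[].
by case=> [E|[d dv]]; [rewrite E eqxx in uv|rewrite side_rev; exists d].
Qed.

Lemma big_darts (V : nmodType) (F : edge T * bool -> V) :
  \sum_d F d = \sum_e (F (e, true) + F (e, false)).
Proof.
rewrite (eq_bigr (fun d => F (d.1, d.2))) => [|[]//].
rewrite -(pair_bigA _ (fun e b => F (e, b))) /=.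
by apply: eq_bigr => e _; rewrite big_bool.
Qed.

(* Seen from [u], exactly one end of each edge has [u] on its far side; as
   there are at most [#|V| - 1] edges, each vertex other than [u] is the end of
   exactly one of them. *)
Lemma far_dart_count u v :
  (\sum_(d | tail d == v) (u \notin side d) = (u != v))%N.
Proof.
(* In this form, equality of the sums over all [w] forces equality of every term. *)
have le w : (u != w <= \sum_(d | tail d == w) (u \notin side d)
    ?= iff ((u != w) == (\sum_(d | tail d == w) (u \notin side d)) :> nat))%N.
  split=> //; have [//|uw] := eqVneq u w; have [d dw ud] := far_dart_exists uw.
  by rewrite (bigD1 d) ?dw//= ud.
have [+ +] := leqif_sum (P := predT) (fun w _ => le w).
have -> : (\sum_w \sum_(d | tail d == w) (u \notin side d) = #|edge T|)%N.
  rewrite (exchange_big_dep predT) //=.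
  rewrite (eq_bigr (fun d => (u \notin side d) : nat)) => [|d _]; last first.
    by apply: big_pred1 => w; rewrite /= eq_sym.
  rewrite [LHS]big_darts -sum1_card.
  by apply: eq_bigr => e _; rewrite (side_rev (e, true)); case: (_ \in _).
have -> : (\sum_(w | predT w) (u != w) = #|vertex T|.-1)%N.
  rewrite (bigD1 u)//= eqxx add0n -(cardC1 u) -sum1_card.
  by apply: eq_big => // w; rewrite eq_sym => ->.
move=> le2.
have -> : (#|vertex T|.-1 == #|edge T|) = true.
  by rewrite eqn_leq le2 /= -ltnS prednK ?card_edges//; apply/card_gt0P; exists u.
by move=> /esym/forallP/(_ v)/eqP ->.
Qed.

Lemma separating_edge u v : u != v ->
  exists e, (u \in side (e, true)) != (v \in side (e, true)).
Proof.
move=> /far_dart_exists[[e b] dv ud]; exists e.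
have vd : v \in side (e, b) by rewrite -dv tail_side.
case: b dv ud vd => _ ud vd; first by rewrite vd (negbTE ud).
by have := side_rev (e, true) u; have := side_rev (e, true) v;
  rewrite /rev_dart /= vd (negbTE ud); case: (u \in _); case: (v \in _).
Qed.

(** * Flows with prescribed divergence on a tree *)

Section Flux.
Variable delta : vertex T -> int.
Hypothesis delta_total : \sum_u delta u = 0.

Definition flux d : int := \sum_(u in side d) delta u.

Lemma flux_compl d : flux d = - \sum_(u | u \notin side d) delta u.
Proof. by apply/eqP; rewrite -addr_eq0 -(bigID _ predT) /= delta_total. Qed.

Lemma flux_rev d : flux (rev_dart d) = - flux d.
Proof.
rewrite [in RHS]flux_compl opprK; apply: eq_bigl => u; exact: side_rev.
Qed.

(** The far sides of the darts at [v] partition the other vertices ([far_dart_count]), and their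
    masses add up to minus that of [v] because the total is zero. *)
Lemma flux_divergence v : \sum_(d | tail d == v) flux d = delta v.
Proof.
rewrite (eq_bigr _ (fun d _ => flux_compl d)) sumrN (exchange_big_dep predT)//=.
transitivity (- (\sum_u delta u - delta v)); last by rewrite delta_total sub0r opprK.
rewrite [in RHS](bigD1 v)//= addrAC subrr add0r; congr (- _).
rewrite [RHS]big_mkcond; apply: eq_bigr => u _.
rewrite big_mkcondr /= (eq_bigr (fun d => delta u *+ (u \notin side d))); last first.
  by move=> d _; case: (_ \notin _).
by rewrite sumrMnr far_dart_count; case: (u != v).
Qed.

End Flux.

Variables (R : realFieldType) (L : edge T -> R) (w : edge T -> nat).
Variable kappa : vertex T -> int.
Hypothesis L_gt0 : forall e, 0 < L e.
Hypothesis w12 : forall e, (w e == 1%N) || (w e == 2%N).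
Hypothesis kappa_ge0 : forall v, 0 <= kappa v.
Hypothesis kappa_even :
  forall v, (2 %| kappa v + \sum_(d | tail d == v) (w d.1)%:Z)%Z.
Hypothesis kappa_total : 2 <= \sum_v kappa v.

(** Summing [kappa_even] over the side counts the edge of [d] once and every other edge twice or not
    at all. Only weight 2 then needs an argument. *)
Lemma weight_dvd_side d : ((w d.1)%:Z %| flux kappa d)%Z.
Proof.
have : (2 %| \sum_(v in side d) (kappa v + \sum_(d' | tail d' == v) (w d'.1)%:Z))%Z.
  by apply: (big_ind (fun x : int => (2 %| x)%Z)) => [|x y|v _]; [exact: dvdz0|exact: rpredD|].
rewrite big_split /= -/(flux kappa d).
have -> : \sum_(v in side d) \sum_(d' | tail d' == v) (w d'.1)%:Z =
    \sum_d' (w d'.1)%:Z *+ (tail d' \in side d).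
  rewrite (exchange_big_dep (fun d' => tail d' \in side d)) => [|v d' vd /eqP ->//].
  rewrite big_mkcond; apply: eq_bigr => d' _; case: ifP => // td'.
  rewrite (big_pred1 (tail d'))// => v.
  by rewrite /= eq_sym andbC; case: eqP => // ->.
rewrite big_darts (bigD1 d.1)//=.
have -> : (w d.1)%:Z *+ (tail (d.1, true) \in side d) +
    (w d.1)%:Z *+ (tail (d.1, false) \in side d) = (w d.1)%:Z.
  have := head_notin_side d; have := tail_side d; rewrite /head /rev_dart.
  by case: d => e [] /= -> /negbTE ->; rewrite ?addr0 ?add0r.
rewrite addrA rpredDr; last first.
  apply: (big_ind (fun x : int => (2 %| x)%Z)) => [|x y|e ne]; [exact: dvdz0|exact: rpredD|].
  have -> := @side_edge d (e, true) ne.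
  rewrite /head /rev_dart /= -mulr2n -[X in (_ %| X)%Z]mulr_natl; exact: dvdz_mulr.
by case/orP: (w12 d.1) => /eqP ->; [rewrite dvd1z|rewrite rpredDr].
Qed.

(** The outgoing slope at the tail of [d] when [c] records slopes along the parametrization of the
    edges. *)
Definition dart_slope (c : edge T -> int) d : int := if d.2 then c d.1 else - c d.1.

(** Both ends of [d0] lie outside [side d], so this side is connected without the edge of [d0] and
    cannot meet both sides of [d0]. *)
Lemma side_nested d d0 : d.1 != d0.1 -> tail d0 \notin side d ->
  forall u, u \in side d -> (u \in side d0) = (tail d \in side d0).
Proof.
move=> ne t0 u ud.
have hd0 : head d0 \notin side d by rewrite -side_edge// eq_sym.
pose S v := v \in side d /\ (v \in side d0) = (tail d \in side d0).
have closed d' : d'.1 \in predC1 d.1 -> S (tail d') -> S (head d').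
  move=> ne' [d'd d'0]; split; first by rewrite -side_edge.
  rewrite -d'0; apply/esym/side_edge; apply/eqP => E.
  have /orP : (tail d' == tail d0) || (tail d' == head d0).
    by move: E; rewrite /head /tail; case: d' d0 {t0 hd0 ne ne' d'd d'0 S} => [e []] [e0 []] /= ->;
      rewrite eqxx ?orbT.
  by case=> /eqP E'; rewrite -E' d'd in t0 hd0.
have conn : connect (adj_in (predC1 d.1)) (tail d) u by rewrite inE in ud.
by have [] := adj_in_closed closed conn (conj (tail_side d) erefl).
Qed.

(** * Moving the chips of one side across an edge *)

Section Firing.
Variable d0 : edge T * bool.
Hypothesis d0_rich : (w d0.1)%:Z <= flux kappa d0.

(* The chips on the near side of [d0] all flow towards its tail, and then as
   many as its weight allows for slope one cross it. *)
Let delta u : int := - (kappa u *+ (u \in side d0)) +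
  (flux kappa d0 - (w d0.1)%:Z) *+ (u == tail d0) + (w d0.1)%:Z *+ (u == head d0).

Lemma sum_pred1 (A : {pred vertex T}) v (x : int) :
  \sum_(u in A) (x *+ (u == v)) = x *+ (v \in A).
Proof.
have [vA|vA] := boolP (v \in A).
  rewrite (bigD1 v)//= eqxx big1 ?addr0// => u /andP[_ /negbTE ->//].
by rewrite big1// => u uA; case: eqP => // E; rewrite -E uA in vA.
Qed.

Lemma flux_firing d : flux delta d =
  - (\sum_(u in side d) kappa u *+ (u \in side d0)) +
  (flux kappa d0 - (w d0.1)%:Z) *+ (tail d0 \in side d) +
  (w d0.1)%:Z *+ (head d0 \in side d).
Proof. by rewrite /flux /delta !big_split /= sumrN !sum_pred1. Qed.

Lemma firing_total : \sum_u delta u = 0.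
Proof.
rewrite /delta !big_split /= sumrN (sum_pred1 predT) (sum_pred1 predT) /= !mulr1n.
rewrite -addrA subrK /flux [in X in _ + X]big_mkcond /=; apply/eqP.
rewrite addrC subr_eq0; apply/eqP; apply: eq_bigr => u _.
by case: (u \in _).
Qed.

(** On a side turned away from [d0], [delta] only removes chips, and by [side_nested] it removes
    either all of them or none. *)
Lemma flux_firing_away d : d.1 != d0.1 -> tail d0 \notin side d ->
  flux delta d = - (flux kappa d *+ (tail d \in side d0)).
Proof.
move=> ne t0; have hd0 : head d0 \notin side d by rewrite -side_edge// eq_sym.
rewrite flux_firing (negbTE t0) (negbTE hd0) !addr0; congr (- _).
rewrite /flux -sumrMnl; apply: eq_bigr => u ud.
by rewrite (side_nested ne t0 ud).
Qed.

Lemma flux_firing_self : flux delta d0 = - (w d0.1)%:Z.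
Proof.
rewrite flux_firing tail_side (negbTE (head_notin_side _)) addr0 mulr1n.
rewrite -[X in _ = X]add0r addrA; congr (_ - _); rewrite addrC; apply/eqP.
by rewrite subr_eq0; apply/eqP; apply: eq_bigr => u ->.
Qed.

(** One of the two directions of an edge other than that of [d0] has its side turned away from [d0],
    where [weight_dvd_side] applies. This makes the division defining [c] exact. *)
Lemma weight_dvd_firing d : ((w d.1)%:Z %| flux delta d)%Z.
Proof.
have [E|ne] := eqVneq d.1 d0.1.
  have [->|->] : d = d0 \/ d = rev_dart d0.
  - rewrite /rev_dart; case: d d0 E => e b [e0 b0] /= ->.
    by case: b b0 => -[]; auto.
  - by rewrite flux_firing_self rpredN.
  - by rewrite (flux_rev firing_total) flux_firing_self opprK.
have away d' : d'.1 = d.1 -> tail d0 \notin side d' -> ((w d.1)%:Z %| flux delta d')%Z.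
  move=> E t0; rewrite flux_firing_away ?E// rpredN; case: (_ \in _).
    by rewrite -E; exact: weight_dvd_side.
  exact: dvdz0.
have [t0|t0] := boolP (tail d0 \in side d); last exact: away.
by rewrite -[flux _ _]opprK -(flux_rev firing_total) rpredN away// side_rev t0.
Qed.

Let c e : int := (flux delta (e, true) %/ (w e)%:Z)%Z.

Lemma firing_slope d : (w d.1)%:Z * dart_slope c d = flux delta d.
Proof.
have cE e : (w e)%:Z * c e = flux delta (e, true).
  by rewrite mulrC divzK//; exact: (weight_dvd_firing (e, true)).
case: d => e [] /=; rewrite /dart_slope /= ?cE//.
by rewrite mulrN cE -(flux_rev firing_total).
Qed.

(** The potential obtained by integrating [c]: each edge contributes its total increment to the
    vertices beyond it, so only the edge itself distinguishes its two ends. *)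
Let F v : R := \sum_e (c e)%:~R * L e * (v \notin side (e, true))%:R.

Lemma firing_step e : F (tgt e) - F (src e) = (c e)%:~R * L e.
Proof.
rewrite /F -sumrB (bigD1 e)//= big1 ?addr0 => [|e' ne].
  have /= := head_notin_side (e, true); have /= := tail_side (e, true).
  by rewrite /head /tail /= => -> ->; rewrite mulr0 subr0 mulr1.
have := @side_edge (e', true) (e, true); rewrite eq_sym /head /tail /= => /(_ ne) ->.
by rewrite subrr.
Qed.

Lemma firing_potential u : F u - F (tail d0) =
  \sum_e (c e)%:~R * L e *
    ((u \notin side (e, true))%:R - (tail d0 \notin side (e, true))%:R).
Proof. by rewrite -sumrB; apply: eq_bigr => e _; rewrite -mulrBr. Qed.

Lemma firing_term d u :
  (c d.1)%:~R * L d.1 * ((u \notin side (d.1, true))%:R - (tail d0 \notin side (d.1, true))%:R) =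
  (dart_slope c d)%:~R * L d.1 * ((u \notin side d)%:R - (tail d0 \notin side d)%:R) :> R.
Proof.
case: d => e [] //=; rewrite /dart_slope /= !(side_rev (e, true)) !negbK mulrNz.
by case: (u \in _); case: (tail d0 \in _) => /=; rewrite ?subrr ?mulr0//;
  rewrite ?subr0 ?sub0r ?mulrN1 ?mulr1 ?mulNr ?opprK.
Qed.

Lemma firing_slope0 : dart_slope c d0 = -1.
Proof.
have w0 : (w d0.1)%:Z != 0 by case/orP: (w12 d0.1) => /eqP ->.
by apply: (mulfI w0); rewrite firing_slope flux_firing_self mulrN1.
Qed.

(** Chips flow towards [d0] on its near side, so the potential does not increase in that direction;
    nothing flows beyond [d0], where it is constant. *)
Lemma firing_term_away d u : d.1 != d0.1 -> tail d0 \notin side d ->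
  let t := (dart_slope c d)%:~R * L d.1 *
    ((u \notin side d)%:R - (tail d0 \notin side d)%:R) : R in
  0 <= t /\ (u \notin side d0 -> t = 0).
Proof.
move=> ne t0 t.
have tE : t = - (dart_slope c d)%:~R * L d.1 * (u \in side d)%:R.
  rewrite /t t0; case: (u \in side d) => /=; first by rewrite sub0r mulrN !mulr1 mulNr.
  by rewrite subrr !mulr0.
have s_le0 : dart_slope c d <= 0.
  have w0 : 0 < (w d.1)%:Z by case/orP: (w12 d.1) => /eqP ->.
  rewrite -(pmulr_rle0 _ w0) firing_slope flux_firing_away//.
  by rewrite oppr_le0 mulrn_wge0// sumr_ge0.
rewrite tE; split.
  by rewrite mulr_ge0 ?ler0n// mulr_ge0 ?(ltW (L_gt0 _))// oppr_ge0 lerz0.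
move=> u0; have [ud|] := boolP (u \in side d); last by rewrite mulr0.
have td : tail d \notin side d0 by rewrite -(side_nested ne t0 ud).
suff -> : dart_slope c d = 0 by rewrite oppr0 !mul0r.
have w0 : (w d.1)%:Z != 0 by case/orP: (w12 d.1) => /eqP ->.
by apply: (mulfI w0); rewrite mulr0 firing_slope flux_firing_away// (negbTE td) oppr0.
Qed.

Lemma firing_term_other e u : e != d0.1 ->
  let t := (c e)%:~R * L e *
    ((u \notin side (e, true))%:R - (tail d0 \notin side (e, true))%:R) : R in
  0 <= t /\ (u \notin side d0 -> t = 0).
Proof.
move=> ne /=; have [t0|t0] := boolP (tail d0 \in side (e, true)); last first.
  by have := @firing_term_away (e, true) u ne t0; rewrite t0.
have t0' : tail d0 \notin side (e, false) by rewrite (side_rev (e, true)) t0.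
have := @firing_term_away (e, false) u ne t0'.
by rewrite /= -(firing_term (e, false)) /= t0.
Qed.

Lemma firing_term_self u : (c d0.1)%:~R * L d0.1 *
    ((u \notin side (d0.1, true))%:R - (tail d0 \notin side (d0.1, true))%:R) =
  - (L d0.1 * (u \notin side d0)%:R) :> R.
Proof.
by rewrite firing_term firing_slope0 tail_side subr0 mulrN1z mulN1r mulNr.
Qed.

(** On the near side [F] is at least its value at the tail of [d0]; on the far side it equals that
    value minus the length of the edge. *)
Lemma firing_separates u v : u \in side d0 -> v \notin side d0 -> F v < F u.
Proof.
move=> ud vd; have Fu : 0 <= F u - F (tail d0).
  rewrite firing_potential (bigD1 d0.1)//= firing_term_self ud mulr0 oppr0 add0r.
  by apply: sumr_ge0 => e ne; have [] := firing_term_other u ne.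
have Fv : F v - F (tail d0) = - L d0.1.
  rewrite firing_potential (bigD1 d0.1)//= firing_term_self vd mulr1 big1 ?addr0//.
  by move=> e ne; have [_] := firing_term_other v ne; exact.
by have := L_gt0 d0.1; lra.
Qed.

(** The weighted divergence is [delta], and [kappa + delta] is the configuration after the move; the
    remainder left at the tail of [d0] is nonnegative by [d0_rich]. *)
Lemma firing_effective v :
  0 <= kappa v + \sum_(d | tail d == v) (w d.1)%:Z * dart_slope c d.
Proof.
rewrite (eq_bigr _ (fun d _ => firing_slope d)) (flux_divergence firing_total) /delta.
rewrite !addrA; apply: addr_ge0; last by rewrite mulrn_wge0.
apply: addr_ge0; last by rewrite mulrn_wge0// subr_ge0.
by case: (v \in _); rewrite ?subrr// subr0.
Qed.

End Firing.

(** A nonnegative multiple of the weight below the weight is 0, and both sides cannot have mass 0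
    since the total is at least 2. *)
Lemma rich_side e0 : exists b, (w e0)%:Z <= flux kappa (e0, b).
Proof.
have tot : flux kappa (e0, true) + flux kappa (e0, false) = \sum_v kappa v.
  rewrite [RHS](bigID [in side (e0, true)]) /=; congr (_ + _).
  by apply: eq_bigl => u; rewrite -(side_rev (e0, true)).
have small b : ~~ ((w e0)%:Z <= flux kappa (e0, b)) -> flux kappa (e0, b) = 0.
  rewrite -ltNge => lt; have := weight_dvd_side (e0, b) => /dvdzP[q E].
  have f0 : 0 <= flux kappa (e0, b) by apply: sumr_ge0.
  by move: lt f0; rewrite E /=; case/orP: (w12 e0) => /eqP -> ? ?; lia.
have [?|/small s1] := boolP ((w e0)%:Z <= flux kappa (e0, true)); first by exists true.
have [?|/small s2] := boolP ((w e0)%:Z <= flux kappa (e0, false)); first by exists false.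
by move: kappa_total; rewrite -tot s1 s2.
Qed.

Lemma tree_section e0 : exists (c : edge T -> int) (F : vertex T -> R),
  [/\ forall e, F (tgt e) - F (src e) = (c e)%:~R * L e,
      c e0 = 1 \/ c e0 = -1,
      forall v, 0 <= kappa v + \sum_(d | tail d == v) (w d.1)%:Z * dart_slope c d &
      forall u v, (u \in side (e0, true)) != (v \in side (e0, true)) -> F u != F v].
Proof.
have [b rich] := rich_side e0; pose d0 := (e0, b).
eexists; eexists; split.
- exact: (@firing_step d0).
- have := firing_slope0 d0; rewrite /dart_slope /=; case: (b) => E; [right|left].
    exact: E.
  exact: oppr_inj.
- exact: (@firing_effective d0 rich).
move=> u v uv.
have sideE x : x \in side d0 = (x \in side (e0, true)) (+) ~~ b.
  by rewrite /d0; case: b {rich d0}; rewrite ?(side_rev (e0, true)) /=; case: (_ \in _).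
have sep x y : x \in side d0 -> y \notin side d0 -> _ := @firing_separates d0 x y.
have [ud|ud] := boolP (u \in side d0); [rewrite gt_eqF|rewrite lt_eqF]; rewrite ?sep//.
  by move: uv ud; rewrite !sideE; case: (b) (u \in _) (v \in _) => -[] [].
by move: uv ud; rewrite !sideE; case: (b) (u \in _) (v \in _) => -[] [].
Qed.

End Darts.

Lemma fsbig_finType (S : Type) (idx : S) (op : Monoid.com_law idx) (I : finType)
    (P : {pred I}) (F : I -> S) :
  \big[op/idx]_(i \in [set i | P i]) F i = \big[op/idx]_(i | P i) F i.
Proof.
by rewrite [RHS]bigfs ?index_enum_uniq// => i _; rewrite mem_index_enum.
Qed.

Lemma fsbig_bool (S : Type) (idx : S) (op : Monoid.com_law idx) (F : bool -> S) :
  \big[op/idx]_(b \in [set: bool]) F b = op (F true) (F false).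
Proof.
transitivity (\big[op/idx]_(b : bool) F b); last by rewrite big_bool.
rewrite -fsbig_finType.
by apply: eq_fsbigl; apply/seteqP; split.
Qed.

(** * Half-edges, valence and the order of edgewise linear functions *)

Section EdgeLinear.
Context {R : realType} {X : metricType R} (G : model X).

Definition dart_pos (d : edge G * bool) : R := if d.2 then 0 else len d.1.

Lemma dart_pos_in (d : edge G * bool) : 0 <= dart_pos d <= len d.1.
Proof. by rewrite /dart_pos; have := len_gt0 d.1; case: (d.2); lra. Qed.

Lemma chart_dart_pos (d : edge G * bool) : chart d.1 (dart_pos d) = vtx (tail d).
Proof.
by rewrite /dart_pos /tail; case: (d.2); [exact: chart_src|exact: chart_tgt].
Qed.

Lemma half_edges_vtx (v : vertex G) : set_bij [set d | tail d = v]
  (half_edge_at (G := G) (vtx v)) (fun d => (d, dart_pos d)).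
Proof.
split=> [d /= dv|d d' _ _ [//]|[[e b] s] [/= xs sP]].
  split=> /=; first by rewrite chart_dart_pos dv.
  by have := len_gt0 d.1; rewrite /dart_pos; case: (d.2); lra.
have sP' : 0 <= s <= len e by case: b sP; lra.
have sE : s = dart_pos (e, b).
  rewrite /dart_pos /=; case/chart_end: sP' => [E|E|i]; last by have := chart_vtx i xs.
    by move: sP; rewrite E; case: b => //; rewrite ltxx.
  by move: sP; rewrite E; case: b => //; rewrite ltxx andbF.
exists (e, b); last by rewrite sE.
by apply: (@vtx_inj _ _ G); rewrite -chart_dart_pos -sE.
Qed.

Lemma half_edges_interior (e : edge G) (s : R) : 0 < s < len e ->
  set_bij [set: bool] (half_edge_at (G := G) (chart e s)) (fun b => (e, b, s)).
Proof.
move=> sP; split=> [b _|b b' _ _ [//]|[[e' b] t] [/= xt tP]].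
  by split=> //=; case: b; lra.
have tP' : 0 <= t <= len e' by case: b tP; lra.
case/chart_end: tP' => [E|E|tP'].
- by move: xt; rewrite E chart_src => /esym/(chart_vtx sP).
- by move: xt; rewrite E chart_tgt => /esym/(chart_vtx sP).
by have [-> ->] := chart_inj tP' sP xt; exists b.
Qed.

Lemma valence_sum (x : X) :
  valence G x = \big[addn/0%N]_(h \in half_edge_at (G := G) x) 1%N.
Proof.
by rewrite fsbig_finite ?sum1_size//; exact: half_edge_at_finite.
Qed.

Lemma valence_vtx (v : vertex G) : valence G (vtx v) = (\sum_(d | tail d == v) 1)%N.
Proof.
rewrite valence_sum (reindex_fsbig _ _ _ _ (half_edges_vtx v)) -fsbig_finType.
by apply: eq_fsbigl; apply/seteqP; split=> d /eqP.
Qed.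

Lemma valence_interior (e : edge G) (s : R) : 0 < s < len e ->
  valence G (chart e s) = 2%N.
Proof.
move=> sP; rewrite valence_sum (reindex_fsbig _ _ _ _ (half_edges_interior sP)).
by rewrite fsbig_bool.
Qed.

Variables (g : X -> R) (a : edge G -> int).
Hypothesis g_linear : forall e (s : R), 0 <= s <= len e ->
  g (chart e s) = g (chart e 0) + (a e)%:~R * s.

Lemma edge_linear_piecewise_linear : piecewise_linear G g.
Proof.
move=> e; exists [::] => s t s0 st tl _; exists (a e) => r rP.
by rewrite (@g_linear e r) ?(@g_linear e s); [ring|lra|lra].
Qed.

Lemma edge_linear_slope (h : half_edge G) x : half_edge_at x h ->
  slope g h = dart_slope a h.1.
Proof.
case: h => [[e b] s] [/= _ sP]; rewrite /slope /dart_slope /=.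
have [eps [eps0 epsP]] : exists eps : R, 0 < eps /\ forall r, 0 <= r <= eps ->
    0 <= (if b then s + r else s - r) <= len e.
  by case: b sP => ?; [exists (len e - s)|exists s]; split=> [|r]; lra.
have s_in : 0 <= s <= len e by case: b sP {epsP}; lra.
have key r : 0 <= r <= eps -> g (half_edge_point (e, b, s) r) =
    g (half_edge_point (e, b, s) 0) + (if b then a e else - a e)%:~R * r.
  move=> rP; have := epsP _ rP; rewrite /half_edge_point /=.
  by case: b {sP epsP} => rP'; rewrite (g_linear rP') ?addr0 ?subr0 (g_linear s_in) ?mulrNz; ring.
apply: xget_unique; first by exists eps.
move=> k [eps' eps'0 kP]; pose m := Num.min eps eps'.
have [m0 m1 m2] : [/\ 0 < m, m <= eps & m <= eps'].
  by rewrite /m lt_min !ge_min !lexx orbT; split=> //; apply/andP.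
have := kP m; rewrite (ltW m0) m2 => /(_ isT); rewrite key; last by rewrite ltW.
by move=> /addrI/(mulIf (lt0r_neq0 m0))/intr_inj ->.
Qed.

Lemma edge_linear_ord_vtx v : ord G g (vtx v) = \sum_(d | tail d == v) dart_slope a d.
Proof.
rewrite /ord (reindex_fsbig _ _ _ _ (half_edges_vtx v)).
rewrite (eq_fsbigr (dart_slope a)) => [|d /set_mem dv]; last first.
  by have [bfun _ _] := half_edges_vtx v; exact: edge_linear_slope (bfun d dv).
rewrite -fsbig_finType.
by apply: eq_fsbigl; apply/seteqP; split=> d /eqP.
Qed.

Lemma edge_linear_ord_interior (e : edge G) (s : R) : 0 < s < len e ->
  ord G g (chart e s) = 0.
Proof.
move=> sP; rewrite /ord (reindex_fsbig _ _ _ _ (half_edges_interior sP)).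
rewrite (eq_fsbigr (fun b => dart_slope a (e, b))) => [|b _]; last first.
  by have [bfun _ _] := half_edges_interior sP; exact: edge_linear_slope (bfun b I).
by rewrite fsbig_bool /dart_slope /= subrr.
Qed.

End EdgeLinear.

(** * The quotient by the involution *)

Section InvolutionQuotient.
Context {R : realType} {X Y : metricType R} (iota : X -> X) (q : X -> Y).
Hypothesis iota_isometric : isometric iota.
Hypothesis iota_involutive : involutive iota.
Hypothesis q_quotient : is_quotient (invol_group iota) q.

Lemma invol_groupP (sigma : X -> X) :
  sigma \in invol_group iota <-> sigma = idfun \/ sigma = iota.
Proof.
rewrite !inE; split=> [/orP[]/eqP ->|[]->]; rewrite ?eqxx ?orbT //; by [left|right].
Qed.

Lemma quotient_eq x x' : q x = q x' <-> x' = x \/ x' = iota x.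
Proof.
have [_ qE _] := q_quotient; rewrite qE; split=> [[sigma /invol_groupP[]-> <-]|[]->].
- by left.
- by right.
- by exists idfun => //; apply/invol_groupP; left.
- by exists iota => //; apply/invol_groupP; right.
Qed.

Lemma quotient_iota x : q (iota x) = q x.
Proof. by apply/quotient_eq; right; rewrite iota_involutive. Qed.

Lemma quotient_surj y : exists x, q x = y.
Proof.
have [qT _ _] := q_quotient; have : range q y by rewrite qT.
by case=> x _ <-; exists x.
Qed.

Lemma quotient_dist x x' :
  mdist (q x) (q x') = Num.min (mdist x x') (mdist x (iota x')).
Proof.
have [_ _ ->] := q_quotient.
have -> : [set mdist x (sigma x') | sigma in [set` invol_group iota]] =
    [set mdist x x'; mdist x (iota x')].
  apply/seteqP; split=> [_ [sigma /invol_groupP[]-> <-]|_ [->|->]]; [by left|by right| |].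
    by exists idfun => //; apply/invol_groupP; left.
  by exists iota => //; apply/invol_groupP; right.
apply/eqP; rewrite eq_le; apply/andP; split; last first.
  by apply: lb_le_inf; [exists (mdist x x'); left|move=> _ [->|->]; rewrite ge_min lexx ?orbT].
have lb : has_lbound [set mdist x x'; mdist x (iota x')].
  by exists 0 => _ [->|->]; exact: mdist_ge0.
by rewrite le_min; apply/andP; split; apply: ge_inf => //; [left|right].
Qed.

Lemma quotient_short x x' : mdist (q x) (q x') <= mdist x x'.
Proof. by rewrite quotient_dist ge_min lexx. Qed.

Lemma quotient_lift x y : exists2 x', q x' = y & mdist x x' = mdist (q x) y.
Proof.
have [x' <-] := quotient_surj y; rewrite quotient_dist.
by case: leP => _; [exists x'|exists (iota x'); rewrite ?quotient_iota].
Qed.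

Lemma invol_short x x' : mdist (iota x) (iota x') <= mdist x x'.
Proof. by rewrite iota_isometric. Qed.

Lemma invol_lift x y : exists2 x', iota x' = y & mdist x x' = mdist (iota x) y.
Proof. by exists (iota y); rewrite ?iota_involutive// -iota_isometric iota_involutive. Qed.

Definition compatible (N : model X) (N' : model Y) : Prop :=
  forall x, (exists v : vertex N, x = vtx v) <-> (exists v : vertex N', q x = vtx v).

(** The order matters: [N'] first receives the images of the vertices of [G], then [N] receives the
    whole fibre of each vertex of [N']. The second step creates no new image, so the process
    stops. *)
Lemma compatible_refinements (G : model X) (H : model Y) (l : seq Y) :
  exists (N : model X) (N' : model Y), [/\ refines G N, refines H N', compatible N N' &
    forall y, y \in l -> exists v : vertex N', y = vtx v].
Proof.
have [N' HN' N'P] := refinement_exists H (l ++ [seq q (vtx v) | v <- enum (vertex G)]).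
have /choice[lift liftP] := quotient_surj.
have [N GN NP] := refinement_exists G
  ([seq lift (vtx v) | v <- enum (vertex N')] ++ [seq iota (lift (vtx v)) | v <- enum (vertex N')]).
exists N, N'; split=> // [x|y yl]; last by apply/N'P; right; rewrite mem_cat yl.
rewrite NP; split=> [[[v ->]|]|[v qx]].
- by apply/N'P; right; rewrite mem_cat (map_f (fun v => q (vtx v))) ?mem_enum ?orbT.
- rewrite mem_cat => /orP[]/mapP[v _ ->]; exists v; by rewrite ?quotient_iota liftP.
right; rewrite mem_cat; have : q (lift (vtx v)) = q x by rewrite liftP.
by move/quotient_eq => [->|->]; apply/orP; [left|right]; apply/mapP; exists v; rewrite ?mem_enum.
Qed.

Section Compatible.
Variables (N : model X) (N' : model Y).
Hypothesis NN' : compatible N N'.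

Lemma quotient_dilates : exists (pi : edge N -> edge N') (fl : edge N -> bool),
  forall e, dilates q e (pi e) (fl e) 1.
Proof.
have /choice[pi piP] := submetry_dilates quotient_short quotient_lift NN'.
by have /choice[fl flP] := piP; exists pi, fl.
Qed.

Lemma invol_dilates : exists (ie : edge N -> edge N) (ifl : edge N -> bool),
  forall e, dilates iota e (ie e) (ifl e) 1.
Proof.
have NN x : (exists v : vertex N, x = vtx v) <-> (exists v : vertex N, iota x = vtx v).
  by rewrite !NN' quotient_iota.
have /choice[ie ieP] := submetry_dilates invol_short invol_lift NN.
by have /choice[ifl iflP] := ieP; exists ie, ifl.
Qed.

Lemma quotient_vertex : exists qv : vertex N -> vertex N', forall v, q (vtx v) = vtx (qv v).
Proof.
have /choice[qv qvP] : forall v : vertex N, exists w : vertex N', q (vtx v) = vtx w.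
  by move=> v; apply/NN'; exists v.
by exists qv.
Qed.

Lemma invol_vertex : exists iv : vertex N -> vertex N, forall v, iota (vtx v) = vtx (iv v).
Proof.
have /choice[iv ivP] : forall v : vertex N, exists w : vertex N, iota (vtx v) = vtx w.
  by move=> v; apply/NN'; rewrite quotient_iota; apply/NN'; exists v.
by exists iv.
Qed.

Variables (pi : edge N -> edge N') (fl : edge N -> bool).
Variables (ie : edge N -> edge N) (ifl : edge N -> bool).
Variables (qv : vertex N -> vertex N') (iv : vertex N -> vertex N).
Hypothesis piP : forall e, dilates q e (pi e) (fl e) 1.
Hypothesis ieP : forall e, dilates iota e (ie e) (ifl e) 1.
Hypothesis qvP : forall v, q (vtx v) = vtx (qv v).
Hypothesis ivP : forall v, iota (vtx v) = vtx (iv v).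
Hypothesis loopless' : loopless N'.

Lemma len_pi e : len (pi e) = len e.
Proof. by have [_ -> _] := piP e; rewrite mul1r. Qed.

Lemma len_ie e : len (ie e) = len e.
Proof. by have [_ -> _] := ieP e; rewrite mul1r. Qed.

Lemma q_chart e (s : R) : 0 <= s <= len e ->
  q (chart e s) = chart (pi e) (if fl e then s else len e - s).
Proof. by have [_ _ h] := piP e => /h ->; rewrite mul1r len_pi. Qed.

Lemma iota_chart e (s : R) : 0 <= s <= len e ->
  iota (chart e s) = chart (ie e) (if ifl e then s else len e - s).
Proof. by have [_ _ h] := ieP e => /h ->; rewrite mul1r len_ie. Qed.

(** Midpoints stand for edges: they are preserved whichever way an edge is flipped, so identities
    between maps of points give identities between maps of edges. *)
Definition midpoint (Z : metricType R) (M : model Z) (e : edge M) : Z :=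
  chart e (len e / 2).

Lemma mid_in (Z : metricType R) (M : model Z) (e : edge M) : 0 < len e / 2 < len e.
Proof. by have := len_gt0 e; lra. Qed.

Lemma midpoint_inj (Z : metricType R) (M : model Z) : injective (@midpoint Z M).
Proof. by move=> e e' /(chart_inj (mid_in _) (mid_in _))[]. Qed.

Lemma q_midpoint e : q (midpoint e) = midpoint (pi e).
Proof.
rewrite /midpoint q_chart; last by have := len_gt0 e; lra.
by rewrite len_pi; congr chart; case: ifP => _; lra.
Qed.

Lemma iota_midpoint e : iota (midpoint e) = midpoint (ie e).
Proof.
rewrite /midpoint iota_chart; last by have := len_gt0 e; lra.
by rewrite len_ie; congr chart; case: ifP => _; lra.
Qed.

Lemma pi_ie e : pi (ie e) = pi e.
Proof. by apply: midpoint_inj; rewrite -!q_midpoint -iota_midpoint quotient_iota. Qed.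

Lemma ieK : involutive ie.
Proof. by move=> e; apply: midpoint_inj; rewrite -!iota_midpoint iota_involutive. Qed.

Lemma pi_fibre e1 e2 : pi e1 = pi e2 -> e2 = e1 \/ e2 = ie e1.
Proof.
move=> E; have /quotient_eq[] : q (midpoint e1) = q (midpoint e2) by rewrite !q_midpoint E.
  by move=> /midpoint_inj; left.
by rewrite iota_midpoint => /midpoint_inj; right.
Qed.

Lemma pi_surj e' : exists e, pi e = e'.
Proof.
have [x qx] := quotient_surj (midpoint e').
have [/NN'[w]|[e [s [sP xE]]]] := chart_cover N x.
  by rewrite qx => /(chart_vtx (mid_in _)).
exists e; move: qx; rewrite xE q_chart; last by lra.
move=> /chart_inj; rewrite len_pi => /(_ _ (mid_in _))[] //.
by case: ifP => _; lra.
Qed.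

Lemma qv_surj w : exists v, qv v = w.
Proof.
have [x qx] := quotient_surj (vtx w).
have [v xv] : exists v : vertex N, x = vtx v by apply/NN'; exists w.
by exists v; apply: (@vtx_inj _ _ N'); rewrite -qvP -xv.
Qed.

Lemma qv_iv v : qv (iv v) = qv v.
Proof. by apply: (@vtx_inj _ _ N'); rewrite -!qvP -ivP quotient_iota. Qed.

Lemma qv_fibre u v : qv u = qv v -> v = u \/ v = iv u.
Proof.
move=> E; have /quotient_eq[] : q (vtx u) = q (vtx v) by rewrite !qvP E.
  by move=> /vtx_inj; left.
by rewrite ivP => /vtx_inj; right.
Qed.

Definition quotient_dart (d : edge N * bool) : edge N' * bool :=
  (pi d.1, if fl d.1 then d.2 else ~~ d.2).

Definition invol_dart (d : edge N * bool) : edge N * bool :=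
  (ie d.1, if ifl d.1 then d.2 else ~~ d.2).

Lemma tail_quotient_dart d : tail (quotient_dart d) = qv (tail d).
Proof.
apply: (@vtx_inj _ _ N'); rewrite -qvP -!chart_dart_pos q_chart ?dart_pos_in//=.
congr chart; rewrite /dart_pos /= len_pi.
by case: (fl _); case: (d.2) => //=; rewrite ?subr0 ?subrr.
Qed.

Lemma tail_invol_dart d : tail (invol_dart d) = iv (tail d).
Proof.
apply: (@vtx_inj _ _ N); rewrite -ivP -!chart_dart_pos iota_chart ?dart_pos_in//=.
congr chart; rewrite /dart_pos /= len_ie.
by case: (ifl _); case: (d.2) => //=; rewrite ?subr0 ?subrr.
Qed.

Lemma dart_eq (d1 d2 : edge N' * bool) : d1.1 = d2.1 -> tail d1 = tail d2 -> d1 = d2.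
Proof.
case: d1 d2 => [e b] [e2 b2] /= <-; have := loopless' e.
by case: b b2 => -[]; rewrite /tail //= => /eqP ne E; case: ne.
Qed.

Lemma quotient_invol_dart d : quotient_dart (invol_dart d) = quotient_dart d.
Proof.
apply: dart_eq; first exact: pi_ie.
by rewrite !tail_quotient_dart tail_invol_dart qv_iv.
Qed.

Lemma quotient_dart_inj (d1 d2 : edge N * bool) :
  d1.1 = d2.1 -> quotient_dart d1 = quotient_dart d2 -> d1 = d2.
Proof.
case: d1 d2 => [e b] [e2 b2] /= <- []; case: (fl e) => [->//|/negb_inj ->//].
Qed.

Lemma quotient_dart_fibre d1 d2 : quotient_dart d1 = quotient_dart d2 ->
  d2 = d1 \/ d2 = invol_dart d1.
Proof.
move=> E; have [] : pi d1.1 = pi d2.1 by case: E.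
move=> /pi_fibre[E1|E1]; [left|right]; apply: quotient_dart_inj => //.
by rewrite quotient_invol_dart.
Qed.

(** A flip would give both darts of the edge the same image, while [q] does not fold any edge of
    [N]. *)
Lemma invol_dart_id d : ie d.1 = d.1 -> invol_dart d = d.
Proof. by move=> E; apply: quotient_dart_inj; rewrite ?quotient_invol_dart. Qed.

Lemma quotient_dart_surj d' : exists d, quotient_dart d = d'.
Proof.
case: d' => e' b'; have [e <-] := pi_surj e'.
exists (e, if fl e then b' else ~~ b').
by rewrite /quotient_dart /=; case: (fl e); rewrite ?negbK.
Qed.

Lemma quotient_dart_at v d' : tail d' = qv v ->
  exists2 d, tail d = v & quotient_dart d = d'.
Proof.
have [d <-] := quotient_dart_surj d'; rewrite tail_quotient_dart => /qv_fibre[E|E].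
  by exists d.
exists (invol_dart d); last exact: quotient_invol_dart.
by rewrite tail_invol_dart -E.
Qed.

Definition weight (e' : edge N') : nat := (\sum_(e | pi e == e') 1)%N.
Definition fibre_card (v' : vertex N') : nat := (\sum_(v | qv v == v') 1)%N.

Lemma weightE e : weight (pi e) = if ie e == e then 1%N else 2%N.
Proof.
rewrite /weight sum1_card; case: eqP => [E|/eqP ne].
  rewrite -(card1 e); apply: eq_card => e2; rewrite !inE; apply/eqP/eqP => [|->//].
  by move=> /esym/pi_fibre[->|->].
rewrite eq_sym in ne; transitivity (e != ie e).+1; last by rewrite ne.
rewrite -card2.
apply: eq_card => e2; rewrite !inE; apply/eqP/orP => [/esym/pi_fibre[->|->]|[]/eqP ->].
- by left.
- by right.
- by [].
- exact: pi_ie.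
Qed.

Lemma fibre_cardE v : fibre_card (qv v) = if iv v == v then 1%N else 2%N.
Proof.
rewrite /fibre_card sum1_card; case: eqP => [E|/eqP ne].
  rewrite -(card1 v); apply: eq_card => v2; rewrite !inE; apply/eqP/eqP => [|->//].
  by move=> /esym/qv_fibre[->|->].
rewrite eq_sym in ne; transitivity (v != iv v).+1; last by rewrite ne.
rewrite -card2.
apply: eq_card => e2; rewrite !inE; apply/eqP/orP => [/esym/qv_fibre[->|->]|[]/eqP ->].
- by left.
- by right.
- by [].
- exact: qv_iv.
Qed.

Lemma weight12 e' : (weight e' == 1%N) || (weight e' == 2%N).
Proof. by have [e <-] := pi_surj e'; rewrite weightE; case: ifP. Qed.

(** The darts over [d'] are spread evenly over the vertices above its tail, because the involution
    permutes these transitively. *)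
Lemma darts_over v d' : tail d' = qv v ->
  (fibre_card (qv v) * \sum_(d | (tail d == v) && (quotient_dart d == d')) 1 =
   weight d'.1)%N.
Proof.
move=> /quotient_dart_at[d dv <-]; rewrite sum1_card fibre_cardE /= weightE.
have fibre d2 : (quotient_dart d2 == quotient_dart d) = (d2 == d) || (d2 == invol_dart d).
  apply/eqP/orP => [/esym/quotient_dart_fibre[->|->]|[]/eqP ->]; rewrite ?eqxx; auto.
  exact: quotient_invol_dart.
have [Ev|ne] := eqVneq (iv v) v; last first.
  have -> : ie d.1 == d.1 = false.
    by apply/eqP => /invol_dart_id E; move: ne; rewrite -dv -tail_invol_dart E eqxx.
  rewrite (_ : #|_| = 1%N)// -(card1 d); apply: eq_card => d2; rewrite !inE unfold_in fibre.
  apply/andP/eqP => [[/eqP d2v /orP[/eqP//|/eqP E]]|->]; last by rewrite dv !eqxx.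
  by move: d2v; rewrite E tail_invol_dart dv => /eqP; rewrite (negbTE ne).
rewrite mul1n; have tE d2 : quotient_dart d2 == quotient_dart d -> tail d2 == v.
  by rewrite fibre => /orP[]/eqP ->; rewrite ?tail_invol_dart dv ?Ev.
rewrite (eq_card (B := [pred d2 | (d2 == d) || (d2 == invol_dart d)])); last first.
  by move=> d2; rewrite !inE unfold_in -fibre;
    case: (boolP (quotient_dart d2 == quotient_dart d)) => [/tE ->|_]; rewrite ?andbF.
case: eqP => [E|/eqP ne].
  rewrite (invol_dart_id E) -(card1 d); by apply: eq_card => d2; rewrite !inE orbb.
rewrite card2 (_ : d != invol_dart d)//; apply: contra ne => /eqP E.
by rewrite {2}E.
Qed.

Lemma sum_darts_over v (h : edge N' * bool -> int) :
  (fibre_card (qv v))%:Z * (\sum_(d | tail d == v) h (quotient_dart d)) =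
  \sum_(d' | tail d' == qv v) (weight d'.1)%:Z * h d'.
Proof.
rewrite (partition_big quotient_dart (fun d' => tail d' == qv v)) => /=; last first.
  by move=> d /eqP <-; rewrite tail_quotient_dart.
rewrite mulr_sumr; apply: eq_bigr => d' /eqP d'v.
rewrite (eq_bigr (fun=> h d')) => [|d /andP[_ /eqP ->//]].
rewrite -(darts_over d'v) sum1_card sumr_const -mulr_natl mulrA; congr (_ * _).
by rewrite PoszM natz.
Qed.

(** * The push-forward of the canonical divisor and sections pulled back from the tree *)

Hypothesis N'_tree : genus N' = 0%N.
Hypothesis N_genus : (2 <= genus N)%N.
Hypothesis N_valence : forall x, valence N x <> 1%N.

Lemma cover_loopless : loopless N.
Proof.
move=> e; apply/eqP => E.
suff /quotient_dart_inj : quotient_dart (e, true) = quotient_dart (e, false).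
  by move=> /(_ erefl).
by apply: dart_eq => //; rewrite !tail_quotient_dart /tail /= E.
Qed.

(** The sum of [val - 2] over the fibre of [v']: the total valence of the fibre is the weighted
    valence of [v'] (see [tree_kappa_fibre]). *)
Definition tree_kappa (v' : vertex N') : int :=
  \sum_(d' | tail d' == v') (weight d'.1)%:Z - 2 * (fibre_card v')%:Z.

Lemma cover_has_edge : (0 < #|edge N|)%N.
Proof.
have [V0 _] := gr_connected N; move: N_genus; rewrite /genus /betti; lia.
Qed.

Lemma valence_ge2 (v : vertex N) : (2 <= valence N (vtx v))%N.
Proof.
have [d dv] := dart_at_exists (gr_connected N) v cover_has_edge.
have := @N_valence (vtx v); suff : (0 < valence N (vtx v))%N by lia.
by rewrite valence_vtx (bigD1 d) ?dv.
Qed.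

Lemma fibre_card_gt0 v' : (0 < fibre_card v')%N.
Proof. by have [v <-] := qv_surj v'; rewrite fibre_cardE; case: ifP. Qed.

Lemma tree_kappa_fibre (v : vertex N) : tree_kappa (qv v) =
  (fibre_card (qv v))%:Z * canonical_div N (vtx v).
Proof.
rewrite /tree_kappa /canonical_div valence_vtx mulrBr (mulrC _ 2); congr (_ - _).
have := sum_darts_over v (fun=> 1).
under [in RHS]eq_bigr => d _ do rewrite mulr1.
by move=> <-; congr (_ * _); rewrite sum1_card sumr_const natz.
Qed.

Lemma tree_kappa_ge0 v' : 0 <= tree_kappa v'.
Proof.
have [v <-] := qv_surj v'; rewrite tree_kappa_fibre mulr_ge0// subr_ge0.
by rewrite lez_nat valence_ge2.
Qed.

Lemma tree_kappa_even v' :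
  (2 %| tree_kappa v' + \sum_(d | tail d == v') (weight d.1)%:Z)%Z.
Proof.
rewrite /tree_kappa addrAC -mulr2n -[X in X - _]mulr_natl -mulrBr; exact: dvdz_mulr.
Qed.

Lemma sum_weight : (\sum_e' weight e' = #|edge N|)%N.
Proof.
rewrite /weight (exchange_big_dep predT)//= -sum1_card; apply: eq_bigr => e _.
by rewrite (big_pred1 (pi e))// => e'; rewrite /= eq_sym.
Qed.

Lemma sum_fibre_card : (\sum_v' fibre_card v' = #|vertex N|)%N.
Proof.
rewrite /fibre_card (exchange_big_dep predT)//= -sum1_card; apply: eq_bigr => v _.
by rewrite (big_pred1 (qv v))// => e'; rewrite /= eq_sym.
Qed.

Lemma tree_kappa_total : 2 <= \sum_v' tree_kappa v'.
Proof.
rewrite /tree_kappa sumrB -mulr_sumr.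
have -> : \sum_(v' : vertex N') (fibre_card v')%:Z = (#|vertex N|)%:Z :> int.
  by rewrite -sum_fibre_card; elim/big_rec2: _ => // i a b _ ->.
have -> : \sum_(v' : vertex N') \sum_(d | tail d == v') (weight d.1)%:Z =
    2 * (#|edge N|)%:Z :> int.
  rewrite (exchange_big_dep predT)//=.
  rewrite (eq_bigr (fun d : edge N' * bool => (weight d.1)%:Z)) => [|d _]; last first.
    by rewrite (big_pred1 (tail d))// => e'; rewrite /= eq_sym.
  rewrite big_darts -sum_weight /= big_split /= -mulr2n -[LHS]mulr_natl.
  by congr (2 * _); elim/big_rec2: _ => // i a b _ ->.
move: N_genus; rewrite /genus /betti; lia.
Qed.

Lemma tree_function_section (h : Y -> R) (c : edge N' -> int) (C : R) :
  0 < C -> (forall y y', `|h y - h y'| <= C * mdist y y') ->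
  (forall e' (s : R), 0 <= s <= len e' ->
     h (chart e' s) = h (chart e' 0) + (c e')%:~R * s) ->
  (forall v', 0 <= tree_kappa v' +
     \sum_(d' | tail d' == v') (weight d'.1)%:Z * dart_slope c d') ->
  inv_sections N (canonical_div N) (invol_group iota) (EFin \o (h \o q)).
Proof.
move=> C0 hL hlin heff; split; last first.
  move=> sigma /invol_groupP[]->; apply/funext => x //=.
  by rewrite quotient_iota.
pose a e := if fl e then c (pi e) else - c (pi e).
have glin e (s : R) : 0 <= s <= len e ->
    (h \o q) (chart e s) = (h \o q) (chart e 0) + (a e)%:~R * s.
  move=> sP; have l0 := len_gt0 e; rewrite /= !q_chart//; [|by lra].
  rewrite /a; case: ifP => _; rewrite hlin ?len_pi//; [|by lra].
  rewrite subr0 [in RHS]hlin ?len_pi; [|by lra].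
  by rewrite mulrNz; ring.
right; exists (h \o q) => //; split.
  split; last exact: edge_linear_piecewise_linear glin.
  apply: (lipschitz_continuous C0) => x x' /=.
  by rewrite (le_trans (hL _ _))// ler_wpM2l ?(ltW C0)// quotient_short.
move=> x; have [[v ->]|[e [s [sP ->]]]] := chart_cover N x; last first.
  by rewrite /canonical_div (valence_interior sP) (edge_linear_ord_interior glin sP).
rewrite (edge_linear_ord_vtx glin).
(* Multiplying by the size of the fibre turns effectivity at [v] into the weighted condition at
   [qv v]. *)
have f0 : 0 < (fibre_card (qv v))%:Z by exact: fibre_card_gt0.
rewrite -(pmulr_rge0 _ f0) mulrDr -tree_kappa_fibre.
rewrite (eq_bigr (fun d => dart_slope c (quotient_dart d))) => [|[e b] _]; last first.
  by rewrite /dart_slope /a /=; case: (fl e); case: b => //=; rewrite opprK.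
by rewrite sum_darts_over.
Qed.

Lemma separating_section (e0 : edge N') : exists (h : Y -> R) (c : edge N' -> int),
  [/\ inv_sections N (canonical_div N) (invol_group iota) (EFin \o (h \o q)),
    forall e' (s : R), 0 <= s <= len e' ->
      h (chart e' s) = h (chart e' 0) + (c e')%:~R * s,
    c e0 = 1 \/ c e0 = -1 &
    forall u v, (u \in side (e0, true)) != (v \in side (e0, true)) ->
      h (vtx u) != h (vtx v)].
Proof.
have [c [F [Fc c0 Feff Fsep]]] := tree_section (gr_connected N') N'_tree
  (@len_gt0 _ _ N') weight12 tree_kappa_ge0 tree_kappa_even tree_kappa_total e0.
have [h [hF hlin [C C0 hL]]] := linear_extension F.
have hlin' e' (s : R) : 0 <= s <= len e' ->
    h (chart e' s) = h (chart e' 0) + (c e')%:~R * s.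
  move=> sP; rewrite hlin// (hlin e' 0) ?mem_len// mulr0 addr0 Fc mulfK//.
  by rewrite gt_eqF// len_gt0.
exists h, c; split=> //.
  exact: tree_function_section C0 hL hlin' Feff.
by move=> u v; rewrite !hF; exact: Fsep.
Qed.

(** The order of the stabilizer by orbit-stabilizer: the order 2 of the group divided by the size of
    the orbit of edges above [e']. *)
Definition mult' (e' : edge N') : nat := (2 %/ weight e')%N.

Definition sheet_degree (x : X) : nat := if iota x == x then 2%N else 1%N.

Definition quotient_half_edge (h : half_edge N) : half_edge N' :=
  (quotient_dart h.1, if fl h.1.1 then h.2 else len h.1.1 - h.2).

Definition invol_half_edge (h : half_edge N) : half_edge N :=
  (invol_dart h.1, if ifl h.1.1 then h.2 else len h.1.1 - h.2).

Lemma dilates_pi e e' b k : dilates q e e' b k -> [/\ e' = pi e, b = fl e & k = 1%N].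
Proof.
move=> [k0 lenE qE]; have l0 := len_gt0 e; have l'0 := len_gt0 e'.
have E : e' = pi e.
  apply: midpoint_inj; rewrite -q_midpoint /midpoint qE; last by lra.
  by congr chart; rewrite lenE; case: b {qE}; lra.
have kE : k = 1%N.
  move: lenE; rewrite E len_pi -{1}(mul1r (len e)) => /(mulIf (lt0r_neq0 l0)) h.
  by apply/eqP; rewrite -(eqr_nat R) -h.
(* The midpoint does not see the direction; the point at a quarter of the edge does. *)
split=> //; subst e' k; have := qE (len e / 4); rewrite q_chart; last by lra.
move=> /(_ _)/chart_inj; rewrite len_pi mul1r => /(_ _ _ _)[].
- by case: (fl e); lra.
- by case: (b); lra.
- by lra.
by case: (b); case: (fl e) => // _ h; exfalso; lra.
Qed.

Lemma half_edge_overE h h' : half_edge_over q h h' <-> quotient_half_edge h = h'.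
Proof.
case: h h' => [[e b] s] [[e' b'] s']; rewrite /half_edge_over /quotient_half_edge /=.
split=> [[c [k [/dilates_pi[-> -> ->] -> ->]]]|].
  by rewrite /quotient_dart /= len_pi mul1r.
move=> [<- <- <-]; exists (fl e), 1%N; split=> //.
by rewrite len_pi mul1r.
Qed.

Lemma half_edge_in (Z : metricType R) (M : model Z) z (h : half_edge M) :
  half_edge_at z h -> 0 <= h.2 <= len h.1.1.
Proof. by case: h => [[e b] s] [/= _]; case: b; lra. Qed.

Lemma invol_half_edge_at x h : half_edge_at x h -> half_edge_at (iota x) (invol_half_edge h).
Proof.
move=> hx; have := half_edge_in hx; case: h hx => [[e b] s] [/= <- sP] sP'.
split; rewrite /= ?iota_chart//.
by rewrite len_ie; case: (ifl e); case: b sP => /=; lra.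
Qed.

Lemma quotient_half_edge_inj (h1 h2 : half_edge N) : h1.1.1 = h2.1.1 ->
  quotient_half_edge h1 = quotient_half_edge h2 -> h1 = h2.
Proof.
case: h1 h2 => [d1 s1] [d2 s2] /= E [E1 E2 E3]; have dE : d1 = d2.
  by apply: quotient_dart_inj => //; rewrite /quotient_dart E1 E2.
rewrite -dE in E3 *; congr (_, _).
by move: E3; case: (fl _); lra.
Qed.

Lemma quotient_invol_half_edge h :
  quotient_half_edge (invol_half_edge h) = quotient_half_edge h.
Proof.
case: h => [d s]; rewrite /quotient_half_edge /= quotient_invol_dart; congr (_, _).
rewrite len_ie; have := quotient_invol_dart (d.1, true) => -[_].
by case: (fl (ie d.1)); case: (fl d.1); case: (ifl d.1) => //= _; lra.
Qed.

Lemma quotient_half_edge_fibre h1 h2 : quotient_half_edge h1 = quotient_half_edge h2 ->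
  h2 = h1 \/ h2 = invol_half_edge h1.
Proof.
move=> E; have [] := quotient_dart_fibre (congr1 fst E : quotient_dart h1.1 = quotient_dart h2.1).
  by move=> dE; left; apply: quotient_half_edge_inj; rewrite ?dE.
move=> dE; right; apply: quotient_half_edge_inj; rewrite ?dE//.
by rewrite quotient_invol_half_edge.
Qed.

Lemma quotient_half_edge_lift x h' : half_edge_at (q x) h' ->
  exists2 h, half_edge_at x h & quotient_half_edge h = h'.
Proof.
move=> hq; have [d dE] := quotient_dart_surj h'.1.
pose s := if fl d.1 then h'.2 else len d.1 - h'.2.
have hE : quotient_half_edge (d, s) = h'.
  rewrite [RHS]surjective_pairing -dE /quotient_half_edge /s /=; congr (_, _).
  by case: (fl d.1) => //; lra.
have sP : 0 <= s <= len d.1.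
  have := half_edge_in hq; rewrite -dE /= len_pi /s; case: (fl _); lra.
have hat : half_edge_at (chart d.1 s) (d, s).
  split=> //=; case: hq => _; rewrite -dE /= len_pi /s.
  by case: d {dE s hE sP} => e b /=; case: (fl e); case: b => /=; lra.
have /quotient_eq[->|->] : q (chart d.1 s) = q x.
  have [<- _] := hq; rewrite q_chart// -[h']hE /=.
  by [].
  by exists (d, s).
exists (invol_half_edge (d, s)); first exact: invol_half_edge_at hat.
by rewrite quotient_invol_half_edge.
Qed.

Lemma mult'E e : mult' (pi e) = if ie e == e then 2%N else 1%N.
Proof. by rewrite /mult' weightE; case: ifP. Qed.

(** Three cases. A fixed edge at [x] gives one half-edge of multiplicity 2 and forces [x] to be
    fixed; two exchanged edges at a fixed [x] give two half-edges of multiplicity 1; at a moved [x]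
    there is one half-edge of multiplicity 1. *)
Lemma cover_local_degree x :
  local_degree (G := N) q (fun=> 1%N) (fun=> 1%N) mult' x (sheet_degree x).
Proof.
move=> h' hq; rewrite /half_edge_degree.
under eq_fsbigr do rewrite divn1 muln1.
have [h hx hE] := quotient_half_edge_lift hq; subst h'.
have setE : [set h2 | half_edge_at x h2 /\ half_edge_over q h2 (quotient_half_edge h)] =
    [set h2 | half_edge_at x h2 /\ (h2 = h \/ h2 = invol_half_edge h)].
  apply/seteqP; split=> h2 /= [h2x]; rewrite half_edge_overE => h2E; split=> //.
    exact: quotient_half_edge_fibre.
  by case: h2E => ->; rewrite ?quotient_invol_half_edge.
rewrite setE /= mult'E /sheet_degree.
have ihx := invol_half_edge_at hx.
have fixE : ie h.1.1 = h.1.1 -> invol_half_edge h = h.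
  by move=> E; apply: quotient_half_edge_inj; rewrite ?quotient_invol_half_edge.
have [E|ne] := eqVneq (ie h.1.1) h.1.1.
  have ix : iota x = x by have [<- _] := ihx; rewrite (fixE E); have [] := hx.
  rewrite ix eqxx (_ : [set h2 | _] = [set h]) ?fsbig_set1//.
  by rewrite fixE//; apply/seteqP; split=> h2 /= => [[_ []]|->]; auto.
have [ix|nx] := eqVneq (iota x) x.
  rewrite ix in ihx; rewrite (_ : [set h2 | _] = [set` [:: h; invol_half_edge h]]); last first.
    apply/seteqP; split=> h2 /= => [[_ [->|->]]|]; rewrite !inE ?eqxx ?orbT//.
    by case/orP => /eqP ->; split; auto.
  rewrite -fsbig_seq ?big_cons ?big_nil//= inE andbT; apply: contra ne => /eqP E.
  by rewrite {2}E.
rewrite (_ : [set h2 | _] = [set h]) ?fsbig_set1//.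
apply/seteqP; split=> h2 /= => [[h2x [//|E]]|->]; last by split=> //; left.
exfalso; move: nx => /eqP; apply; have [<- _] := ihx; rewrite -E.
by have [] := h2x.
Qed.

(** * The quotient map as a Galois covering *)

Hypothesis iota_neq_id : iota <> idfun :> (X -> X).

Lemma card_invol_group : #|` invol_group iota|%fset = 2%N.
Proof. by rewrite cardfs2 eq_sym; have /eqP -> := iota_neq_id. Qed.

Lemma invol_isometry_group : isometry_group (invol_group iota).
Proof.
split.
- by apply/invol_groupP; left.
- move=> sigma tau /invol_groupP[]-> /invol_groupP[]->; apply/invol_groupP.
  + by left.
  + by right.
  + by right.
  + by left; apply/funext => x; exact: iota_involutive.
- by move=> sigma /invol_groupP[]->; [exists idfun|exists iota] => //;
    apply/invol_groupP; [left|right].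
by move=> sigma /invol_groupP[]->.
Qed.

(** Treats open and closed edges at once, both parameter sets being symmetric about the midpoint.
    One inclusion for all edges suffices since [iota] is an involution. *)
Lemma image_iota (A : edge N -> set R) e :
  (forall e1 e2 s, len e1 = len e2 -> A e1 s -> A e2 s /\ A e2 (len e2 - s)) ->
  (forall e s, A e s -> 0 <= s <= len e) ->
  iota @` [set chart e s | s in A e] = [set chart (ie e) s | s in A (ie e)].
Proof.
move=> Asym Ain; have half e1 : iota @` [set chart e1 s | s in A e1] `<=`
    [set chart (ie e1) s | s in A (ie e1)].
  move=> _ [_ [s sA <-] <-]; rewrite iota_chart; last exact: Ain.
  have [A1 A2] := Asym e1 (ie e1) s (esym (len_ie e1)) sA.
  by eexists; last reflexivity; case: (ifl e1) => //; rewrite -(len_ie e1).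
apply/seteqP; split; first exact: half.
move=> x xA; exists (iota x); last exact: iota_involutive.
by have := half (ie e) (iota x); rewrite ieK; apply; exists x.
Qed.

Lemma image_relint e : iota @` edge_relint e = edge_relint (ie e).
Proof.
apply: (@image_iota (fun e => [set s : R | 0 < s < len e])) => /= [e1 e2 s ->|e1 s]; last lra.
by move=> h; split; lra.
Qed.

Lemma image_edge_set e : iota @` edge_set e = edge_set (ie e).
Proof.
apply: (@image_iota (fun e => [set s : R | 0 <= s <= len e])) => //= e1 e2 s -> h.
by split; lra.
Qed.

Lemma edge_set_inj (e1 e2 : edge N) : edge_set e1 = edge_set e2 -> e1 = e2.
Proof.
move=> E; have : edge_set e2 (midpoint e1).
  by rewrite -E; exists (len e1 / 2) => //=; have := len_gt0 e1; lra.
case=> s /chart_end[->|->|sP] /esym.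
- by rewrite chart_src => /(chart_vtx (mid_in _)).
- by rewrite chart_tgt => /(chart_vtx (mid_in _)).
- by move=> /(chart_inj (mid_in _) sP)[].
Qed.

Lemma card_edge_stab e : #|` edge_stab (invol_group iota) e|%fset = mult' (pi e).
Proof.
rewrite mult'E; case: eqP => [E|ne].
  rewrite -card_invol_group; congr (#|` _|); apply/fsetP => sigma.
  rewrite !inE /=; apply/andP/idP => [[]//|h]; split=> //; apply/asboolP.
  by case/orP: h => /eqP ->; rewrite ?image_id// image_edge_set E.
rewrite (_ : edge_stab _ e = [fset (idfun : X -> X)]%fset) ?cardfs1//.
apply/fsetP => sigma; rewrite !inE /=; apply/andP/eqP => [[/orP[]/eqP -> //]|->].
  by move/asboolP; rewrite image_edge_set => /edge_set_inj.
by rewrite eqxx; split=> //; apply/asboolP; rewrite image_id.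
Qed.

Lemma cover_is_morphism : is_morphism (G := N) q N' (fun=> 1%N).
Proof.
split.
- exact: lipschitz1_continuous quotient_short.
- by move=> v; exists (qv v).
- move=> e'; exists [set e | pi e == e']%SET; apply/seteqP; split=> [x [t tP qx]|x].
    have [[v xv]|[e [s [sP xs]]]] := chart_cover N x.
      by move: qx; rewrite xv qvP => /(chart_vtx tP).
    exists e; last by exists s.
    move: qx; rewrite xs q_chart; last by lra.
    move=> /(chart_inj tP)/=; rewrite len_pi => /(_ _)[]; first by case: (fl e); lra.
    by move=> ->; rewrite inE eqxx.
  move=> [e /=]; rewrite inE => /eqP <- [s /= sP <-].
  exists (if fl e then s else len e - s); first by rewrite /= len_pi; case: (fl e); lra.
  by rewrite q_chart//; lra.
by move=> e; right; exists (pi e), (fl e).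
Qed.

Lemma cover_has_degree :
  has_degree (G := N) q (fun=> 1%N) (fun=> 1%N) mult' #|` invol_group iota|%fset.
Proof.
exists sheet_degree; first exact: cover_local_degree.
move=> y; rewrite card_invol_group; have [x <-] := quotient_surj y.
have [ix|nx] := eqVneq (iota x) x.
  rewrite (_ : q @^-1` _ = [set x]) ?fsbig_set1 /sheet_degree ?ix ?eqxx//.
  by apply/seteqP; split=> x' /= => [/esym/quotient_eq[]->|->].
rewrite (_ : q @^-1` _ = [set` [:: x; iota x]]); last first.
  apply/seteqP; split=> x' /= => [/esym/quotient_eq[]->|]; rewrite !inE ?eqxx ?orbT//.
  by case/orP => /eqP ->; rewrite ?quotient_iota.
rewrite -fsbig_seq ?big_cons ?big_nil/=; last by rewrite inE eq_sym nx.
by rewrite /sheet_degree iota_involutive (negbTE nx) eq_sym (negbTE nx).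
Qed.

Lemma cover_galois :
  galois_covering (G := N) (G' := N') q (fun=> 1%N) (fun=> 1%N) mult' (invol_group iota).
Proof.
split.
- exact: invol_isometry_group.
- split; first by split=> //; exact: cover_is_morphism.
  split.
  + exact: cover_loopless.
  + exact: loopless'.
  + by split=> // e'; rewrite /mult'; case/orP: (weight12 e') => /eqP ->.
  + have /card_gt0P[e _] := cover_has_edge.
    exists (vtx (src (pi e))), (vtx (tgt (pi e))) => /vtx_inj.
    by apply/eqP; exact: loopless'.
  + move=> x; split; first by move=> h e' _ _; exact: dvd1n.
    by exists (sheet_degree x); exact: cover_local_degree.
- exact: cover_has_degree.
- by have [_ qE _] := q_quotient.
move=> sigma /invol_groupP[]-> e; first by exists e; rewrite ?image_id.
by exists (ie e); rewrite ?image_relint.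
Qed.

Lemma cover_stab (e : edge N) (e' : edge N') : edge_over q e e' ->
  mult' e' = #|` edge_stab (invol_group iota) e|%fset.
Proof. by move=> [b [k /dilates_pi[-> _ _]]]; rewrite card_edge_stab. Qed.

End Compatible.
End InvolutionQuotient.

(** * Invariant sections of the canonical divisor *)

Section HyperellipticQuotient.
Context {R : realType} {X Y : metricType R} (G : model X) (H : model Y).
Variables (iota : X -> X) (q : X -> Y).
Hypothesis G_genus : (2 <= genus G)%N.
Hypothesis G_valence : forall x : X, valence G x <> 1%N.
Hypothesis iota_isometric : isometric iota.
Hypothesis iota_involutive : involutive iota.
Hypothesis iota_neq_id : iota <> idfun :> (X -> X).
Hypothesis q_quotient : is_quotient (invol_group iota) q.
Hypothesis H_tree : genus H = 0%N.

Let S := inv_sections G (canonical_div G) (invol_group iota).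

Lemma refined_sections (N : model X) f : refines G N ->
  inv_sections N (canonical_div N) (invol_group iota) f -> S f.
Proof. by move=> GN [Nf finv]; split=> //; apply: (refines_sections GN). Qed.

Lemma refined_hypotheses (N : model X) (N' : model Y) : refines G N -> refines H N' ->
  [/\ genus N' = 0%N, (2 <= genus N)%N, forall x, valence N x <> 1%N & loopless N'].
Proof.
move=> GN [gN' _ _]; have gN'0 : genus N' = 0%N by rewrite gN'.
split=> //.
- by have [-> _ _] := GN.
- by rewrite (refines_valence GN).
- exact: (tree_loopless (gr_connected N') gN'0).
Qed.

Lemma galois_covering_exists : exists (N : model X) (N' : model Y)
    (deg : edge N -> nat) (m' : edge N' -> nat),
  galois_covering q deg (fun=> 1%N) m' (invol_group iota) /\
  forall (e : edge N) (e' : edge N'), edge_over q e e' ->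
    m' e' = #|` edge_stab (invol_group iota) e|%fset.
Proof.
have [N [N' [GN HN' NN' _]]] := compatible_refinements iota_involutive q_quotient G H [::].
have [gN' gN vN lN'] := refined_hypotheses GN HN'.
have [pi [fl piP]] := quotient_dilates iota_involutive q_quotient NN'.
have [ie [ifl ieP]] := invol_dilates iota_isometric iota_involutive q_quotient NN'.
have [qv qvP] := quotient_vertex NN'.
have [iv ivP] := invol_vertex iota_involutive q_quotient NN'.
exists N, N', (fun=> 1%N), (mult' pi); split.
  by apply: (cover_galois (iota := iota) (q := q)); eauto.
by move=> e e'; apply: (cover_stab (iota := iota) (q := q)); eauto.
Qed.

(** For a constant function the condition is that the push-forward of the canonical divisor is
    effective. *)
Lemma constant_section : S (EFin \o cst 0).
Proof.
have [N [N' [GN HN' NN' _]]] := compatible_refinements iota_involutive q_quotient G H [::].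
have [gN' gN vN lN'] := refined_hypotheses GN HN'.
have [pi [fl piP]] := quotient_dilates iota_involutive q_quotient NN'.
have [ie [ifl ieP]] := invol_dilates iota_isometric iota_involutive q_quotient NN'.
have [qv qvP] := quotient_vertex NN'.
have [iv ivP] := invol_vertex iota_involutive q_quotient NN'.
apply: (refined_sections GN).
apply: (tree_function_section iota_involutive q_quotient NN' piP ieP qvP ivP lN'
  (h := cst 0) (c := fun=> 0) (C := 1)) => //.
- by move=> y y'; rewrite subrr normr0 mul1r mdist_ge0.
- by move=> e' s _; rewrite mul0r addr0.
move=> v'; rewrite big1 ?addr0 => [|d _]; last first.
  by rewrite /dart_slope oppr0; case: ifP; rewrite mulr0.
exact: (tree_kappa_ge0 iota_involutive q_quotient NN' piP ieP qvP ivP lN' gN' gN vN).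
Qed.

(** Once both points are vertices of the tree, some edge has them on different sides, and the
    section built from that edge distinguishes its sides. *)
Lemma sections_separate (y y' : Y) : y <> y' -> exists2 h : Y -> R,
  S (EFin \o (h \o q)) & h y <> h y'.
Proof.
move=> yy'; have [N [N' [GN HN' NN' ly]]] :=
  compatible_refinements iota_involutive q_quotient G H [:: y; y'].
have [gN' gN vN lN'] := refined_hypotheses GN HN'.
have [pi [fl piP]] := quotient_dilates iota_involutive q_quotient NN'.
have [ie [ifl ieP]] := invol_dilates iota_isometric iota_involutive q_quotient NN'.
have [qv qvP] := quotient_vertex NN'.
have [iv ivP] := invol_vertex iota_involutive q_quotient NN'.
have [u yu] : exists u : vertex N', y = vtx u by apply: ly; rewrite !inE eqxx.
have [v yv] : exists v : vertex N', y' = vtx v by apply: ly; rewrite !inE eqxx orbT.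
have uv : u != v by apply/eqP => uv; apply: yy'; rewrite yu yv uv.
have [e0 sep] := separating_edge (gr_connected N') gN' uv.
have [h [c [hS _ _ hsep]]] := separating_section iota_involutive q_quotient NN'
  piP ieP qvP ivP lN' gN' gN vN e0.
exists h; first exact: (refined_sections GN).
by rewrite yu yv; apply/eqP; exact: hsep.
Qed.

(** The increasing germ of [e] at the midpoint [m] comes from an edge [e1] of the refinement, which
    covers a piece of [e] to the right of [m]; the section is built from the image of [e1]. *)
Lemma unit_slope_section (e : edge G) (s t : R) : 0 <= s -> s < t -> t <= len e ->
  exists (g : X -> R) (s1 t1 : R) (k : int), [/\ S (EFin \o g),
    k = 1 \/ k = -1, s <= s1 /\ s1 < t1, t1 <= t &
    forall r, s1 <= r <= t1 -> g (chart e r) = g (chart e s1) + k%:~R * (r - s1)].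
Proof.
move=> s0 st tl; pose m := (s + t) / 2.
have [N [N' [GN HN' NN' ly]]] :=
  compatible_refinements iota_involutive q_quotient G H [::].
have [gN' gN vN lN'] := refined_hypotheses GN HN'.
have [pi [fl piP]] := quotient_dilates iota_involutive q_quotient NN'.
have [ie [ifl ieP]] := invol_dilates iota_isometric iota_involutive q_quotient NN'.
have [qv qvP] := quotient_vertex NN'.
have [iv ivP] := invol_vertex iota_involutive q_quotient NN'.
have [sm mt] : s < m /\ m < t by rewrite /m; split; lra.
have [_ _ [ed [off [ch bij]]]] := GN.
have [_ _ surj] := bij (chart e m).
have /surj[[[e1 b] sg] [/= _ sgP] [E1 E2 E3]] :
  half_edge_at (chart e m) (e, true, m) by split=> //=; lra.
subst b; have [h [c [hS hlin c1 _]]] := separating_section iota_involutive q_quotient NN'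
  piP ieP qvP ivP lN' gN' gN vN (pi e1).
(* On [e1] the point [m] has parameter [sg], so [e1] reaches [len e1 - sg] beyond [m]. *)
pose t1 := Num.min t (m + (len e1 - sg)).
have [m1 t1t t1e] : [/\ m < t1, t1 <= t & t1 <= m + (len e1 - sg)].
  by rewrite /t1 lt_min !ge_min !lexx orbT; split=> //; apply/andP; split; lra.
clearbody m t1.
exists (h \o q), m, t1, (if fl e1 then c (pi e1) else - c (pi e1)); split=> //.
- exact: (refined_sections GN).
- by case: (fl e1); case: c1 => ->; rewrite ?opprK; auto.
- by split=> //; lra.
have chE r : chart e r = chart e1 (r - off e1).
  by rewrite ch E1; congr chart; lra.
move=> r rP; have r1 : 0 <= r - off e1 <= len e1 by lra.
have m1' : 0 <= m - off e1 <= len e1 by lra.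
rewrite /= !chE !(q_chart piP)//.
have lp := len_pi piP e1.
case: (fl e1).
  rewrite (hlin _ (r - off e1)) ?(hlin _ (m - off e1)) ?lp//.
  by ring.
rewrite (hlin _ (len e1 - (r - off e1))) ?(hlin _ (len e1 - (m - off e1))) ?lp; last first.
- by lra.
- by lra.
by rewrite mulrNz; ring.
Qed.

End HyperellipticQuotient.

(** * The image of the rational map *)

Section GeneratorsOverReals.
Context {R : realType} (T : Type) (n : nat) (f : 'I_n -> T -> \bar R).
Variable S : set (T -> \bar R).
Hypothesis f_gen : minimal_generating f S.
Hypothesis S_real : forall phi, S phi -> phi = cst -oo%E \/ exists g : T -> R, phi = EFin \o g.

(** A generator equal to the constant [-oo] adds nothing to any maximum, so minimality excludes
    it. *)
Lemma generator_real : exists g : 'I_n -> T -> R, forall i, f i = EFin \o g i.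
Proof.
suff /choice[g gP] : forall i, exists g : T -> R, f i = EFin \o g by exists g.
move=> i; have [[fS fgen] fmin] := f_gen.
have [fi|//] := S_real (fS i (finset.in_setT i)); exfalso.
have /fmin/setP/(_ i) : generates f [set~ i]%SET S.
  split=> [j _|phi /fgen[a a_fin phiE]]; first exact: fS.
  exists a => // x; rewrite phiE (bigD1 i) ?inE//= fi /= addeNy max_r ?leNye//.
  by apply: eq_bigl => j; rewrite !inE.
by rewrite !inE eqxx.
Qed.

Variable g : 'I_n -> T -> R.
Hypothesis fg : forall i, f i = EFin \o g i.

(* At each point some generator, shifted to agree with [phi] there, lies below
   [phi] everywhere. *)
Lemma generator_below (phi : T -> R) (x : T) : S (EFin \o phi) ->
  exists i, forall x', g i x' - g i x <= phi x' - phi x.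
Proof.
have [[_ fgen] _] := f_gen; move=> /fgen[a a_fin phiE].
have below i x' : (a i + (g i x')%:E <= (phi x')%:E)%E.
  have := phiE x' => /= ->; rewrite -[(g i x')%:E]/((EFin \o g i) x') -fg.
  by apply: le_bigmax_cond; rewrite inE.
have : \big[maxe/-oo%E]_(i in [set: 'I_n]%SET) (a i + f i x)%E = -oo%E \/
    exists i, \big[maxe/-oo%E]_(i in [set: 'I_n]%SET) (a i + f i x)%E = (a i + f i x)%E.
  apply: (big_ind (fun y => y = -oo%E \/ exists i, y = (a i + f i x)%E)).
  - by left.
  - by move=> y z yP zP; rewrite maxEle; case: ifP.
  - by move=> i _; right; exists i.
rewrite -phiE /= => -[//|[i]]; rewrite fg /= => E; exists i => x'.
have := below i x'; case: (a i) E => [r|//|//] /= [->].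
by rewrite lee_fin; lra.
Qed.

End GeneratorsOverReals.

(** Cutting at one break point at a time reduces an additive statement to break-free segments; [min]
    and [max] allow both directions. *)
Lemma break_induction (R : realFieldType) (Q : R -> R -> Prop) (brk : seq R) :
  (forall s r t, Num.min s t < r < Num.max s t -> Q s r -> Q r t -> Q s t) ->
  (forall s t, (forall r, r \in brk -> ~~ (Num.min s t < r < Num.max s t)) -> Q s t) ->
  forall s t, Q s t.
Proof.
move=> cat; elim: brk => [|b brk IH] noB s t; first exact: noB.
apply: IH => {}s {}t nb.
have [sbt|nsbt] := boolP (Num.min s t < b < Num.max s t); last first.
  by apply: noB => r; rewrite inE => /orP[/eqP ->//|]; exact: nb.
have part u v : (u = s /\ v = b) \/ (u = b /\ v = t) -> Q u v.
  move=> uv; apply: noB => r rb; apply/negP => /andP[r1 r2].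
  have [E|ne] := eqVneq r b.
    move: r1 r2; rewrite E gt_min lt_max.
    by case: uv => -[-> ->]; rewrite ltxx ?orbF /= => /lt_gtF ->.
  move: rb; rewrite inE (negbTE ne) /= => /nb/negP; apply.
  move: sbt r1 r2; rewrite !gt_min !lt_max.
  by case: uv => -[-> ->]; case: (ltgtP s t); lra.
by apply: (cat s b t) => //; apply: part; [left|right].
Qed.

Lemma no_break_interval (R : realFieldType) (brk : seq R) (s t : R) : s < t ->
  exists2 t', s < t' <= t & forall r, r \in brk -> ~~ (s < r < t').
Proof.
elim: brk => [|b brk IH] st; first by exists t; rewrite ?st ?lexx.
have [t' /andP[st' t't] nb] := IH st.
have [sb|bs] := ltP s b; last first.
  exists t'; rewrite ?st'// => r; rewrite inE => /orP[/eqP ->|/nb//].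
  by rewrite ltNge bs.
exists (Num.min b t') => [|r]; first by rewrite lt_min sb st' ge_min t't orbT.
rewrite inE lt_min => /orP[/eqP ->|/nb]; first by rewrite ltxx andbF.
by apply: contra => /and3P[-> _ ->].
Qed.

(** By Bezout, the natural numbers [m] with [theta * m] integral are closed under gcd. *)
Lemma integral_multiple_gcd (R : realType) (theta : R) (n : nat) (w : 'I_n -> int) :
  \big[gcdn/0%N]_(j < n) `|w j|%N = 1%N ->
  (forall j, exists z : int, theta * (w j)%:~R = z%:~R) ->
  exists z : int, theta = z%:~R.
Proof.
move=> w1 wz; pose P (m : nat) := exists z : int, theta * m%:R = z%:~R.
suff [z zE] : P 1%N by exists z; rewrite -zE mulr1.
rewrite -w1; apply: (big_ind P) => [|m k [a aE] [b bE]|j _].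
- by exists 0; rewrite mulr0.
- have [u [v uvE]] := Bezoutz m k; exists (u * a + v * b).
  rewrite (_ : (gcdn m k)%:R = (gcdz m k)%:~R)// -uvE !intrD !intrM -aE -bE.
  by rewrite -!pmulrn; ring.
have [z zE] := wz j; exists (if 0 <= w j then z else - z).
rewrite pmulrn abszE; have [w0|w0] := leP 0 (w j); first by rewrite ger0_norm.
by rewrite ltr0_norm// !mulrNz mulrN zE.
Qed.

Section ImageOfSystem.
Context {R : realType} {X Y : metricType R} (G : model X) (q : X -> Y).
Variables (n : nat) (g : 'I_n -> X -> R) (S : set (X -> \bar R)).
Hypothesis q_surj : forall y, exists x, q x = y.
Hypothesis q_short : forall x x', mdist (q x) (q x') <= mdist x x'.
Hypothesis q_lift : forall x y, exists2 x', q x' = y & mdist x x' = mdist (q x) y.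
Hypothesis g_linear : forall i, piecewise_linear G (g i).
Hypothesis g_invariant : forall i x x', q x = q x' -> g i x = g i x'.
Hypothesis g_below : forall phi x, S (EFin \o phi) ->
  exists i, forall x', g i x' - g i x <= phi x' - phi x.
Hypothesis S_constant : S (EFin \o cst 0).
Hypothesis S_separate : forall y y' : Y, y <> y' -> exists2 h : Y -> R,
  S (EFin \o (h \o q)) & h y <> h y'.
Hypothesis S_unit_slope : forall (e : edge G) (s t : R), 0 <= s -> s < t -> t <= len e ->
  exists (phi : X -> R) (s1 t1 : R) (k : int), [/\ S (EFin \o phi),
    k = 1 \/ k = -1, s <= s1 /\ s1 < t1, t1 <= t &
    forall r, s1 <= r <= t1 -> phi (chart e r) = phi (chart e s1) + k%:~R * (r - s1)].

Let f (i : 'I_n) : X -> \bar R := EFin \o g i.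

Lemma rational_map_trop x : @trop_proj R n (rational_map f x).
Proof.
exists (fun i => f i x) => //; split=> //.
by have [i _] := g_below x S_constant; exists i.
Qed.

Lemma tp_class_eq (u v : 'I_n -> R) : tp_class (EFin \o u) = tp_class (EFin \o v) ->
  exists l : R, forall i, u i = v i + l.
Proof.
move=> E; have : tp_class (EFin \o u) (EFin \o u) by exists 0 => i; rewrite /= addr0.
by rewrite E => -[l lE]; exists l => i; have := lE i => /= -[].
Qed.

(** The constant section provides a generator that is maximal at [x] and one that is maximal at
    [x'], so the scaling constant [l] is 0. Generators lying below a separating section at the two
    points then force its two values to agree. *)
Lemma rational_map_eq x x' : rational_map f x = rational_map f x' <-> q x = q x'.
Proof.
split=> [|qE]; last first.
  by rewrite /rational_map; congr tp_class; apply/funext => i; rewrite /f /= (g_invariant i qE).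
move=> /(@tp_class_eq (g^~ x) (g^~ x'))[l lE].
have l0 : l = 0.
  have [i /(_ x') iP] := g_below x S_constant; have [j /(_ x) jP] := g_below x' S_constant.
  by move: iP jP; rewrite !lE /=; lra.
apply: contrapT => /S_separate[h hS]; apply.
have [i /(_ x') iP] := g_below x hS; have [j /(_ x) jP] := g_below x' hS.
by move: iP jP; rewrite !lE l0 /=; lra.
Qed.

(** The generator touching [phi] from below at the midpoint of the interval stays below it on both
    sides, so the two slopes agree. *)
Lemma generator_of_slope (e : edge G) (s t : R) (k : 'I_n -> R) (phi : X -> R)
    (s1 t1 l : R) : S (EFin \o phi) ->
  (forall i r, s <= r <= t -> g i (chart e r) = g i (chart e s) + k i * (r - s)) ->
  s <= s1 -> s1 < t1 -> t1 <= t ->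
  (forall r, s1 <= r <= t1 -> phi (chart e r) = phi (chart e s1) + l * (r - s1)) ->
  exists i, k i = l.
Proof.
move=> phiS gk ss1 st1 t1t phil; pose d := (t1 - s1) / 2.
have d0 : 0 < d by rewrite /d; lra.
have dE : t1 = s1 + 2 * d by rewrite /d; lra.
clearbody d; have [i iP] := g_below (chart e (s1 + d)) phiS; exists i.
have := iP (chart e (s1 + 2 * d)); have := iP (chart e s1).
rewrite !(gk i (_ + _)) ?(gk i s1) ?(phil (_ + _)); [|lra..].
move=> h1 h2; have h1' : d * (l - k i) <= 0 by lra.
have h2' : 0 <= d * (l - k i) by lra.
have : d * (l - k i) = 0 by lra.
by move/eqP; rewrite mulf_eq0 gt_eqF//= subr_eq0 => /eqP.
Qed.

Lemma slope_integral (h : X -> R) (e : edge G) (s t c k : R) : piecewise_linear G h ->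
  0 <= s -> s < t -> t <= len e ->
  (forall r, s <= r <= t -> h (chart e r) = c + k * r) -> exists z : int, k = z%:~R.
Proof.
move=> pl s0 st tl hk; have [brk brkP] := pl e.
have [t' /andP[st' t't] nb] := no_break_interval brk st.
have [z zP] := brkP s t' s0 (ltW st') (le_trans t't tl) nb; exists z.
have := zP t'; rewrite lexx (ltW st') => /(_ isT).
rewrite !hk ?lexx ?(ltW st) ?(ltW st')// => E.
have t's : t' - s != 0 by rewrite subr_eq0 gt_eqF.
by apply: (mulIf t's); lra.
Qed.

(** The generator of slope 0 serves as reference coordinate, so the direction vector consists of the
    slopes themselves; it is primitive and nonzero because some slope is 1 or -1. *)
Lemma segment_step (e : edge G) (s t : R) : 0 <= s <= len e -> 0 <= t <= len e ->
  (forall i, exists c k : R, forall r, Num.min s t <= r <= Num.max s t ->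
     g i (chart e r) = c + k * r) ->
  s != t ->
  image_step G f (rational_map f (chart e s)) (rational_map f (chart e t)) `|s - t|.
Proof.
move=> sP tP lin st; exists e, s, t; split=> //.
  by move=> i; have [c [k ck]] := lin i; exists c, k => r /ck; rewrite /f /= => ->.
right; set lo := Num.min s t; set hi := Num.max s t.
have [lohi lo0 hil] : [/\ lo < hi, 0 <= lo & hi <= len e].
  by rewrite /lo /hi; case: (ltgtP s t) st => // *; split=> //; lra.
have [sin tin] : lo <= s <= hi /\ lo <= t <= hi.
  by rewrite /lo /hi; case: (leP s t) => ?; split; lra.
have /choice[k kP] : forall i, exists k : int, forall r, lo <= r <= hi ->
    g i (chart e r) = g i (chart e lo) + k%:~R * (r - lo).
  move=> i; have [c [k ck]] := lin i.
  have [z zE] := slope_integral (@g_linear i) lo0 lohi hil ck; exists z => r rP.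
  by rewrite !ck ?lexx ?(ltW lohi)// zE; ring.
have [i0 k0] : exists i, (k i)%:~R = 0 :> R.
  apply: (generator_of_slope (k := fun i => (k i)%:~R) S_constant kP (lexx lo) lohi (lexx hi)).
  by move=> r _ /=; rewrite mul0r addr0.
have [phi [s1 [t1 [z [phiS z1 [ss1 st1] t1t phiz]]]]] := S_unit_slope lo0 lohi hil.
have [i1 k1] := generator_of_slope (k := fun i => (k i)%:~R) phiS kP ss1 st1 t1t phiz.
have diff j : g j (chart e s) - g j (chart e t) = (k j)%:~R * (s - t).
  by rewrite (kP _ s)// (kP _ t)//; ring.
split.
- by rewrite normr_gt0 subr_eq0.
- move=> /(@tp_class_eq (g^~ (chart e s)) (g^~ (chart e t)))[l lE].
  have := diff i0; have := diff i1; rewrite k0 k1 !lE => h1 h0.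
  have : z%:~R * (s - t) = 0 by lra.
  move/eqP; rewrite mulf_eq0 subr_eq0 (negbTE st) orbF intr_eq0.
  by case: z1 => ->.
exists (g^~ (chart e s)), (g^~ (chart e t)); split=> //.
(* The sign compensates for writing [s - t] as a multiple of [|s - t|]. *)
exists i0, (fun j => if t <= s then k j else - k j); split.
  apply/eqP; rewrite -dvdn1; apply: (@biggcdn_inf _ i1) => //.
  have -> : k i1 = z by apply: (@intr_inj R).
  by case: ifP => _; case: z1 => ->.
move=> j /=.
have -> : g j (chart e s) - g i0 (chart e s) - (g j (chart e t) - g i0 (chart e t)) =
   (g j (chart e s) - g j (chart e t)) - (g i0 (chart e s) - g i0 (chart e t)) by ring.
rewrite !diff k0 mul0r subr0.
by case: (leP t s) => ts; [rewrite ger0_norm|rewrite ltr0_norm]; rewrite ?mulrNz; lra.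
Qed.

Lemma edge_chain (e : edge G) (s t : R) : 0 <= s <= len e -> 0 <= t <= len e ->
  chain (image_step G f) (rational_map f (chart e s)) (rational_map f (chart e t)) `|s - t|.
Proof.
have /choice[brk brkP] := fun i => g_linear i e.
pose all := flatten [seq brk i | i <- enum 'I_n].
move: s t; apply: (@break_induction _ (fun s t => 0 <= s <= len e -> 0 <= t <= len e ->
  chain (image_step G f) (rational_map f (chart e s)) (rational_map f (chart e t)) `|s - t|)
  all).
  move=> s r t rP sr rt sP tP.
  have rP' : 0 <= r <= len e by move: rP; case: (leP s t) => ?; lra.
  have -> : `|s - t| = `|s - r| + `|r - t|.
    move: rP; case: (leP s t) => ? ?; first by rewrite !ler0_norm; lra.
    by rewrite !ger0_norm; lra.
  exact: chain_cat (sr sP rP') (rt rP' tP).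
move=> s t nb sP tP; have [->|st] := eqVneq s t.
  by rewrite subrr normr0; exact: chain_nil.
rewrite -(addr0 `|s - t|); apply: chain_cons (chain_nil _ _).
apply: segment_step => // i.
have [|||r rb|k kP] := brkP i (Num.min s t) (Num.max s t).
- by case: (leP s t) => ?; lra.
- by case: (leP s t) => ?; lra.
- by case: (leP s t) => ?; lra.
- by apply: nb; apply/flattenP; exists (brk i) => //; apply: map_f; rewrite mem_enum.
exists (g i (chart e (Num.min s t)) - k%:~R * Num.min s t), k%:~R => r /kP ->.
by ring.
Qed.

Lemma image_step_ge0 P Q a : image_step G f P Q a -> 0 <= a.
Proof. by move=> [e [s [t [_ _ _ _ [[_ ->]//|[/ltW]]]]]]. Qed.

(** In the nontrivial case [|s - t| <= a] suffices. Normalized increments of the generators are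
    integral multiples of [s - t] and also [a] times a primitive vector, so [a] itself is such a
    multiple, nonzero since [a > 0]. *)
Lemma image_step_dist (x x' : X) a :
  image_step G f (rational_map f x) (rational_map f x') a -> mdist (q x) (q x') <= a.
Proof.
move=> [e [s [t [sP tP lin [/rational_map_eq qs /rational_map_eq qt] st]]]].
rewrite -qs -qt; case: st => [[/rational_map_eq E ->]|[a0 PQ [u [v [Pu Qv [i [w [w1 wE]]]]]]]].
  by rewrite -qs in E; rewrite E qt mdistxx.
apply: le_trans (q_short _ _) _; apply: le_trans (mdist_chart_le sP tP) _.
have [E|st] := eqVneq s t.
  by rewrite E subrr normr0 ltW.
have /rational_map_eq Ps := qs; have /rational_map_eq Pt := qt.
rewrite -Ps in Pu; rewrite -Pt in Qv.
have [lu luE] := tp_class_eq (u := g^~ (chart e s)) Pu.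
have [lv lvE] := tp_class_eq (u := g^~ (chart e t)) Qv.
have [lohi lo0 hil] : [/\ Num.min s t < Num.max s t, 0 <= Num.min s t & Num.max s t <= len e].
  by case: (ltgtP s t) st => // *; split=> //; lra.
have slope j : exists z : int, g j (chart e s) - g j (chart e t) = z%:~R * (s - t).
  have [c [k ck]] := lin j.
  have ck' r : Num.min s t <= r <= Num.max s t -> g j (chart e r) = c + k * r.
    by move=> /ck[].
  have [z zE] := slope_integral (@g_linear j) lo0 lohi hil ck'; exists z.
  rewrite !ck' -?zE; [ring| |]; by rewrite ge_min le_max lexx ?orbT.
have st0 : s - t != 0 by rewrite subr_eq0.
have [z zE] : exists z : int, a / (s - t) = z%:~R.
  apply: (integral_multiple_gcd w1) => j.
  have [zj zjE] := slope j; have [zi ziE] := slope i; exists (zj - zi).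
  apply: (mulIf st0); rewrite mulrAC divfK// -wE intrB mulrBl -zjE -ziE.
  by rewrite (luE i) (luE j) (lvE i) (lvE j); ring.
have aE : a = z%:~R * (s - t) by rewrite -zE divfK.
rewrite -[a]gtr0_norm// aE normrM ler_peMl// -intr_norm ler1z.
have : z != 0 by apply: contraTneq a0 => z0; rewrite aE z0 mul0r ltxx.
by rewrite -normr_gt0 gtz0_ge1.
Qed.

(** A chain passes through classes, not points of [X]; a point above each class is picked as the
    induction proceeds. *)
Lemma image_chain_dist P Q L : chain (image_step G f) P Q L ->
  forall x, P = rational_map f x ->
  exists2 x', Q = rational_map f x' & mdist (q x) (q x') <= L.
Proof.
elim=> [{}P x ->|{}P P1 {}Q a b st _ IH x Px]; first by exists x; rewrite ?mdistxx.
have [x1 P1x] : exists x1, P1 = rational_map f x1.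
  by have [e [s [t [_ _ _ [_ <-] _]]]] := st; exists (chart e t).
have [x2 Qx x12] := IH x1 P1x; exists x2 => //.
apply: le_trans (metric_triangle _ (q x1) _) _; apply: lerD x12.
by apply: image_step_dist; rewrite -Px -P1x.
Qed.

(** One inequality is [image_chain_dist]. For the other, [x'] is replaced by a point of its fibre
    that realizes the distance, and chains of [X] are pushed to the image with the same length. *)
Lemma image_distance (x x' : X) :
  mdist (q x) (q x') = chain_dist (image_step G f) (rational_map f x) (rational_map f x').
Proof.
have lift_chain x1 x2 L : chain (edge_step (@len _ _ G) (@chart _ _ G)) x1 x2 L ->
    chain (image_step G f) (rational_map f x1) (rational_map f x2) L.
  elim=> [{}x1|{}x1 y {}x2 a b [e [s [t [sP tP <- <- ->]]]] _ IH]; first exact: chain_nil.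
  exact: chain_cat (edge_chain sP tP) IH.
apply/eqP; rewrite eq_le; apply/andP; split.
  have [L0 /lift_chain cL0] := model_chain G x x'.
  apply: chain_dist_ge cL0 _ => L cL.
  have [x2 /rational_map_eq -> //] := image_chain_dist cL erefl.
have [x2 qx2 <-] := q_lift x (q x').
have -> : rational_map f x' = rational_map f x2 by apply/rational_map_eq.
rewrite (model_dist G).
have [L0 cL0] := model_chain G x x2.
apply: chain_dist_ge cL0 _ => L /lift_chain cL.
by apply: chain_dist_le cL; exact: image_step_ge0.
Qed.

Lemma image_of_system : exists beta : Y -> set ('I_n -> \bar R),
  is_image G f beta /\ forall x, beta (q x) = rational_map f x.
Proof.
have /choice[lift liftP] := q_surj.
have betaE x : rational_map f (lift (q x)) = rational_map f x.
  by apply/rational_map_eq; rewrite liftP.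
exists (fun y => rational_map f (lift y)); split=> //; split.
- by move=> y y' /rational_map_eq; rewrite !liftP.
- apply/seteqP; split=> [_ [y _ <-]|_ [x _ <-]]; first by exists (lift y).
  by exists (q x).
by move=> y y'; rewrite -image_distance !liftP.
Qed.

End ImageOfSystem.

Theorem theorem1p0p11 (R : realType) (X : metricType R) (G : model X)
    (hyperelliptic_X : hyperelliptic G)
    (no_one_valent : forall x : X, valence G x <> 1%N)
    (iota : X -> X) (iota_hyp : hyperelliptic_involution iota)
    (n : nat) (f : 'I_n -> X -> \bar R)
    (f_gen : minimal_generating f
       (inv_sections G (canonical_div G) (invol_group iota))) :
  (forall x, @trop_proj R n (rational_map f x)) /\
  exists (Y : metricType R) (beta : Y -> set ('I_n -> \bar R)) (phi : X -> Y),
    [/\ is_image G f beta,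
      is_tree Y,
      forall x, beta (phi x) = rational_map f x &
      exists (N : model X) (N' : model Y)
             (deg : edge N -> nat) (m' : edge N' -> nat),
        galois_covering phi deg (fun=> 1%N) m' (invol_group iota) /\
        forall (e : edge N) (e' : edge N'), edge_over phi e e' ->
          m' e' = #|` edge_stab (invol_group iota) e|%fset ].
Proof.
have [G_genus _] := hyperelliptic_X.
have [iota_iso iota_inv iota_id [Y [q [q_quot [H H_tree]]]]] := iota_hyp.
pose S := inv_sections G (canonical_div G) (invol_group iota).
have S_real phi : S phi -> phi = cst -oo%E \/ exists g : X -> R, phi = EFin \o g.
  by move=> [[->|[g _ ->]] _]; [left|right; exists g].
have [g fg] := generator_real f_gen S_real.
have g_section i : S (EFin \o g i).
  by rewrite -fg; have [[fS _] _] := f_gen; exact: fS (finset.in_setT i).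
have g_linear i : piecewise_linear G (g i).
  (* A real-valued function is not the constant [-oo], as any vertex shows. *)
  have [[E|[g' [[_ gl] _] E]] _] := g_section i.
    have [/card_gt0P[v _] _] := gr_connected G.
    by have := congr1 (@^~ (vtx v)) E.
  rewrite (_ : g i = g')//; apply/funext => x.
  by have := congr1 (@^~ x) E => -[].
have g_invariant i x x' : q x = q x' -> g i x = g i x'.
  move=> /(quotient_eq q_quot)[->//|->]; have [_ inv] := g_section i.
  have /inv E : iota \in invol_group iota by apply/invol_groupP; right.
  by have := congr1 (@^~ x) E => -[].
have g_below phi x := @generator_below _ _ _ _ _ f_gen g fg phi x.
have q_short := quotient_short q_quot.
have q_lift := quotient_lift iota_inv q_quot.
have S_const := constant_section G_genus no_one_valent iota_iso iota_inv q_quot H_tree.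
have S_sep := sections_separate G_genus no_one_valent iota_iso iota_inv q_quot H_tree.
have S_unit := unit_slope_section G_genus no_one_valent iota_iso iota_inv q_quot H_tree.
have fE : f = fun i => EFin \o g i by apply/funext.
have [beta [beta_image betaE]] := image_of_system (quotient_surj q_quot) q_short q_lift
  g_linear g_invariant g_below S_const S_sep S_unit.
split; first by rewrite fE => x; exact: rational_map_trop g_below S_const x.
exists Y, beta, q; rewrite fE; split=> //; first by exists H.
exact: galois_covering_exists G_genus no_one_valent iota_iso iota_inv iota_id q_quot H_tree.
Qed.
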